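(* Let $\Phi$ be a continuous semiflow on a Banach space $(X,\|\cdot\|_X)$ which is eventually compact and possesses a global attractor $\Gamma$, and suppose that $\Phi$ is uniformly eventually strongly monotone (UESM) with respect to nested invariant cones (NICs) $\{C^i\}_{i=0}^{N}$. Suppose moreover that there is a closed linear subspace $\Pi\subset X$ of codimension $d$ such that, for every $1\le i\le N$ and all distinct $x,y\in\mathcal{B}(\Phi)$, the following implication holds: if for every $s>0$ there exist $\tilde x,\tilde y\in\mathcal{B}(\Phi)$ with $\Phi_s(\tilde x)=x$, $\Phi_s(\tilde y)=y$ and $\Phi_t(\tilde x)-\Phi_t(\tilde y)\in(C^i\setminus C^{i-1})\cup\{0\}$ for all $t\ge0$, then $x-y\notin\Pi$. Suppose also that the restriction of $\Phi$ to $\Gamma$ extends to a continuous flow on $\Gamma$. If $d=1$ or $d=2$, then the topological entropy of $\Phi$ is $0$.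
   Context: **Semiflows.** A continuous semiflow on a Banach space $X$ is a continuous map $\Phi:[0,\infty)\times X\to X$, $\Phi_t(x)=\Phi(t,x)$, with $\Phi_0=\mathrm{id}$ and $\Phi_t\circ\Phi_s=\Phi_{t+s}$ for $t,s\ge0$. It is eventually compact if there is $\tau>0$ such that $\Phi_\tau(D)$ is relatively compact for every bounded $D\subset X$. A set $A$ is invariant if $\Phi_t(A)=A$ for all $t\ge0$. A global attractor is a nonempty compact invariant set $\Gamma\subset X$ with $\lim_{t\to+\infty}\sup_{a\in\Phi_t(D)}\inf_{b\in\Gamma}\|a-b\|_X=0$ for every bounded $D\subset X$. The $\omega$-limit set is $\omega(x)=\bigcap_{t\ge0}\overline{\bigcup_{s\ge t}\{\Phi_s(x)\}}$. The point $x$ is recurrent if $x\in\omega(x)$; $\mathcal{R}(\Phi)$ is the set of recurrent points, and the Birkhoff center is $\mathcal{B}(\Phi)=\overline{\mathcal{R}(\Phi)}$. The topological entropy of $\Phi$ is understood as the topological entropy of the time-one map $\Phi_1|_\Gamma$ on the compact global attractor $\Gamma$. **Cones.** A closed set $C\subset X$ is a $k$-cone if $lv\in C$ for all $v\in C$, $l\in\mathbb{R}$, and $\max\{\dim W: W\subset C \text{ a linear subspace}\}=k$. It is solid if $\operatorname{Int}C\ne\emptyset$. (Cones are not assumed convex.) **UESM.** $\Phi$ is UESM with respect to a solid cone $C$ if there is $T(C)>0$ such that $x-y\in C\setminus\{0\}$ implies $\Phi_t(x)-\Phi_t(y)\in\operatorname{Int}C$ for all $t\ge T(C)$. **NICs.**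 A sequence of closed sets $\{C^i\}_{i=0}^N$, $N\in\mathbb{N}\cup\{+\infty\}$, is called NICs for $\Phi$ if: (i) $\{0\}=C^0\subset\dots\subset C^{i-1}\subset C^i\subset\dots\subset C^N=X$; (ii) $C^i$ is a solid $k_i$-cone for all $0<i<N$, with $k_{i-1}<k_i$ for all $1<i<N$; (iii) for each $1\le i<N$ there is $t_*^i\ge0$ such that $x-y\in C^i$ implies $\Phi_t(x)-\Phi_t(y)\in C^i$ for every $t\ge t_*^i$. $\Phi$ is UESM with respect to the NICs if it is UESM with respect to $C^i$ for every $1\le i<N$. **Convention.** If $N=+\infty$, the indices are $0,1,2,\dots$ together with $\infty$ (with $C^\infty=X$), and $C^{\infty-1}$ means $\bigcup_{i<\infty}C^i$. *)

(* Defs.v *)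
From mathcomp Require Import all_boot all_order all_algebra.
From mathcomp Require Import all_classical all_reals all_analysis.
Import Order.TTheory GRing.Theory Num.Theory.
Import numFieldNormedType.Exports.

Set Implicit Arguments.
Unset Strict Implicit.
Unset Printing Implicit Defensive.

Local Open Scope classical_set_scope.
Local Open Scope ring_scope.

Section Semiflow.
Variables (R : realType) (X : completeNormedModType R).
Implicit Types (Phi Psi : R -> X -> X) (A D Gamma : set X) (x y : X).

(* A semiflow is a function of all real times whose values at negative times
   are irrelevant: every definition below only uses Phi t for 0 <= t. *)
Definition continuous_semiflow Phi : Prop :=
  [/\ {within [set p : R * X | 0 <= p.1], continuous (fun p => Phi p.1 p.2)},
      forall x, Phi 0 x = x &
      forall t s x, 0 <= t -> 0 <= s -> Phi t (Phi s x) = Phi (t + s) x].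

Definition eventually_compact Phi : Prop :=
  exists2 tau : R, 0 < tau &
    forall D, bounded_set D -> precompact (Phi tau @` D).

Definition flow_invariant Phi A : Prop :=
  forall t : R, 0 <= t -> Phi t @` A = A.

(* The empty set D, on which the supremum of a nonnegative quantity is 0 by
   convention but ereal_sup is -oo, is excluded. *)
Definition attracts Phi Gamma D : Prop :=
  D !=set0 ->
  ereal_sup [set ereal_inf [set `|a - b|%:E | b in Gamma] | a in Phi t @` D]
    @[t --> +oo] --> 0%E.

Definition global_attractor Phi Gamma : Prop :=
  [/\ Gamma !=set0, compact Gamma, flow_invariant Phi Gamma &
      forall D, bounded_set D -> attracts Phi Gamma D].

Definition omega_limit Phi x : set X :=
  \bigcap_(t in [set t : R | 0 <= t])
    closure [set Phi s x | s in [set s : R | t <= s]].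

Definition recurrent_points Phi : set X := [set x | omega_limit Phi x x].

Definition Birkhoff_center Phi : set X := closure (recurrent_points Phi).

(* Psi is only meaningful on Gamma, but at all real times. *)
Definition continuous_flow_on Gamma Psi : Prop :=
  [/\ {within [set p : R * X | Gamma p.2], continuous (fun p => Psi p.1 p.2)},
      forall t x, Gamma x -> Gamma (Psi t x),
      forall x, Gamma x -> Psi 0 x = x &
      forall t s x, Gamma x -> Psi t (Psi s x) = Psi (t + s) x].

Definition extends_to_flow Phi Gamma : Prop :=
  exists2 Psi, continuous_flow_on Gamma Psi &
    forall t x, 0 <= t -> Gamma x -> Psi t x = Phi t x.

End Semiflow.

Section Entropy.
Variables (R : realType) (X : completeNormedModType R).
Implicit Types (f : X -> X) (K : set X).

Definition separated f K (n : nat) (eps : R) (E : seq X) : Prop :=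
  [/\ uniq E, (forall x, x \in E -> K x) &
      forall x y, x \in E -> y \in E -> x != y ->
        exists2 j : nat, (j < n)%N & eps < `|iter j f x - iter j f y|].

(* 1/n times the logarithm of the maximal cardinality of an (n, eps)-separated
   subset of K *)
Definition separation_rate f K (eps : R) (n : nat) : \bar R :=
  ereal_sup [set (ln (size E)%:R / n%:R : R)%:E | E in separated f K n eps].

(* Bowen's topological entropy of f restricted to a compact set K with
   f @` K `<=` K. The limit as eps decreases to 0 is a supremum because
   the inner limsup is nonincreasing in eps. *)
Definition topological_entropy f K : \bar R :=
  ereal_sup [set limn_esup (separation_rate f K eps)
            | eps in [set eps : R | 0 < eps]].

Definition semiflow_entropy (Phi : R -> X -> X) (Gamma : set X) : \bar R :=
  topological_entropy (Phi 1) Gamma.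

End Entropy.

Section Subspaces.
Variables (R : realType) (X : completeNormedModType R).
Implicit Types (W Pi C : set X).

Definition linear_subspace W : Prop := submod_closed [in W].

Definition lincomb (n : nat) (e : 'I_n -> X) (a : 'I_n -> R) : X :=
  \sum_(i < n) a i *: e i.

(* the linear subspace W has finite dimension n: it has a basis of n vectors *)
Definition has_dim W (n : nat) : Prop :=
  exists e : 'I_n -> X,
    (forall a, lincomb e a = 0 -> forall i, a i = 0) /\
    W = [set lincomb e a | a in setT].

(* X / Pi has dimension n: it has a basis, consisting of the classes of e *)
Definition has_codim Pi (n : nat) : Prop :=
  exists e : 'I_n -> X,
    (forall a, Pi (lincomb e a) -> forall i, a i = 0) /\
    (forall x, exists a, Pi (x - lincomb e a)).

Definition cone_of_rank (k : nat) C : Prop :=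
  [/\ closed C,
      forall v (l : R), C v -> C (l *: v),
      exists W, [/\ linear_subspace W, W `<=` C & has_dim W k] &
      forall W, linear_subspace W -> W `<=` C ->
        exists2 m : nat, (m <= k)%N & has_dim W m].

Definition solid C : Prop := interior C !=set0.

End Subspaces.

(* Indices in nat with +oo added; None is +oo. *)
Definition xnat : Type := option nat.

Definition xnat_le (i j : xnat) : bool :=
  match i, j with
  | _, None => true
  | None, Some _ => false
  | Some m, Some n => (m <= n)%N
  end.

Definition xnat_lt (i j : xnat) : bool := ~~ xnat_le j i.

Section NestedCones.
Variables (R : realType) (X : completeNormedModType R).
Implicit Types (Phi : R -> X -> X) (N : xnat) (C : xnat -> set X).

Definition uesm_cone Phi (K : set X) : Prop :=
  exists2 T : R, 0 < T &
    forall x y, (K `\ 0) (x - y) ->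
      forall t, T <= t -> interior K (Phi t x - Phi t y).

(* C^(i-1) for i >= 1, with C^(oo-1) the union of the C^i for finite i *)
Definition prev_cone C (i : xnat) : set X :=
  match i with
  | Some m => C (Some m.-1)
  | None => \bigcup_m C (Some m)
  end.

(* Only the values of C at indices at most N are relevant. *)
Definition NICs Phi N C : Prop :=
  (forall i, xnat_le i N -> closed (C i)) /\
  [/\ [/\ C (Some 0%N) = [set 0],
          (forall i, xnat_le (Some 1%N) i -> xnat_le i N ->
             prev_cone C i `<=` C i) &
          C N = setT],
      (exists k : nat -> nat,
         (forall i : nat, (0 < i)%N -> xnat_lt (Some i) N ->
            cone_of_rank (k i) (C (Some i)) /\ solid (C (Some i))) /\
         (forall i : nat, (1 < i)%N -> xnat_lt (Some i) N ->
            (k i.-1 < k i)%N)) &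
      (forall i : nat, (1 <= i)%N -> xnat_lt (Some i) N ->
         exists2 t0 : R, 0 <= t0 &
           forall x y, C (Some i) (x - y) ->
             forall t, t0 <= t -> C (Some i) (Phi t x - Phi t y))].

Definition uesm Phi N C : Prop :=
  forall i : nat, (1 <= i)%N -> xnat_lt (Some i) N ->
    uesm_cone Phi (C (Some i)).

End NestedCones.

(* Main.v *)
Require Import Defs.
From mathcomp Require Import all_boot all_order all_algebra.
From mathcomp Require Import all_classical all_reals all_analysis.
From mathcomp Require Import ring lra zify.
Import Order.TTheory GRing.Theory Num.Theory.
Import numFieldNormedType.Exports.
Set Implicit Arguments.
Unset Strict Implicit.
Unset Printing Implicit Defensive.
Local Open Scope classical_set_scope.
Local Open Scope ring_scope.

(* A recurrent point x of the flow on Gamma has an orbit closure Z in the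
   Birkhoff center. The pairs of points of the orbit of x are dense in Z x Z and
   recurrent for the product flow, while entering a cone C^i is irreversible and
   stable under perturbation: hence on pairs of distinct points of Z the index i
   with difference in C^i but not in C^(i-1) is constant in time, and the
   hypothesis on Pi makes the projection along Pi injective on Z.

   A flow projecting injectively to the plane has only periodic recurrent
   orbits. Let p be the projected orbit of x. Up to the time S of a close return
   to p 0, take the closest pair p a, p b of points lying on distinct strands
   near p 1: the segment between them does not meet the rest of the curve, so
   p a .. p b closed by this segment is a loop. An argument function of
   p t - p s on s < t shows that the winding numbers of the loop around the
   points before and after it differ by an odd number; but p 0 and p S can be
   joined without crossing the loop.

   Finally, if all recurrent points of a continuous self-map of a compact set are
   almost periodic, its entropy vanishes: an orbit spends most of its time where
   a short stretch predicts a much longer one, because non-recurrent points are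
   visited rarely, and can therefore be encoded by few letters. *)

(** * Polar angles *)

Section Angle.
Variable R : realType.
Implicit Types (a b t : R).

Definition polar (z1 z2 t : R) : Prop :=
  exists2 r, 0 < r & z1 = r * cos t /\ z2 = r * sin t.

Lemma cosD2pi_int t (n : int) : cos (t + 2 * pi * n%:~R) = cos t.
Proof.
have H (m : nat) (s : R) : cos (s + 2 * pi * m%:R) = cos s.
  have := periodicn (@cosD2pi R) m s; rewrite -[RHS]/(cos s) => <-; congr cos.
  by rewrite -mulr_natr; ring.
case: n => m; first by rewrite -[X in _ * X]/(m%:R) H.
by rewrite NegzE mulrNz mulrN -[RHS](H m.+1) -[in RHS](subrK (2 * pi * m.+1%:R) t)
  H.
Qed.

Lemma round2pi t : exists n : int, - pi <= t - 2 * pi * n%:~R < pi.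
Proof.
have pi0 := @pi_gt0 R.
exists (Num.floor ((t + pi) / (2 * pi))).
have := floor_itv ((t + pi) / (2 * pi)) => /andP[].
rewrite ler_pdivlMr ?ltr_pdivrMr; [|lra|lra].
by rewrite intrD mulrDl => h1 h2; apply/andP; split; lra.
Qed.

(** The cosine is -1 exactly at the odd multiples of [pi], so by the intermediate value theorem [f]
    cannot leave the window between two consecutive ones in which it starts; [n] numbers this
    window. *)
Lemma cos_neqN1_window (f : R -> R) a b : a <= b -> continuous f ->
  (forall x, a <= x <= b -> cos (f x) <> -1) ->
  exists n : int, forall x, a <= x <= b -> `|f x - 2 * pi * n%:~R| < pi.
Proof.
move=> ab cf H; have [n /andP[n1 n2]] := round2pi (f a).
exists n => x /andP[ax xb]; rewrite ltr_norml.
have K v : a <= v <= b -> f v <> 2 * pi * n%:~R + pi /\ f v <> 2 * pi * n%:~R - pi.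
  move=> vab; split=> E; apply: (H v vab); rewrite E addrC cosD2pi_int ?cosN //;
    exact: cospi.
have ivt v : Num.min (f a) (f x) <= v <= Num.max (f a) (f x) -> exists2 c,
  a <= c <= b & f c = v.
  move=> /(IVT ax (continuous_subspaceT cf))[c + fc]; rewrite in_itv /= => /andP[c1 c2].
  by exists c => //; lra.
have [Ka1 Ka2] := K a ltac:(lra).
apply/andP; split; rewrite ltNge; apply/negP => h.
- have [|c cab fc] := ivt (2 * pi * n%:~R - pi); last by have [] := K c cab.
  by rewrite ge_min le_max; apply/andP; split; apply/orP; [right|left]; lra.
- have [|c cab fc] := ivt (2 * pi * n%:~R + pi); last by have [] := K c cab.
  by rewrite ge_min le_max; apply/andP; split; apply/orP; [left|right]; lra.
Qed.

(** Two duplications show [cos (pi / 8) < 19 / 20]: otherwise [cos (pi / 4)] would be at least 4 / 5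
    and [cos (pi / 2)] positive. *)
Lemma cos_ge_near t (n : int) : `|t - 2 * pi * n%:~R| < pi -> 19 / 20 <= cos t ->
  `|t - 2 * pi * n%:~R| < pi / 8.
Proof.
set h := t - _ => hpi; have pi0 := @pi_gt0 R.
have -> : cos t = cos `|h|.
  by rewrite cos_norm -(cosD2pi_int h n) /h subrK.
move=> ch; rewrite ltNge; apply/negP => h8.
have : cos `|h| <= cos (pi / 8) by have h0 := normr_ge0 h;
  rewrite leNgt ltr_cos ?in_itv /= -?leNgt //; lra.
have e1 := cos_mulr2n (pi / 8 : R); have e2 := cos_mulr2n (pi / 4 : R).
have x1 : (pi / 8) *+ 2 = pi / 4 :> R by rewrite -mulr_natr; field.
have x2 : (pi / 4) *+ 2 = pi / 2 :> R by rewrite -mulr_natr; field.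
move: e1 e2; rewrite x1 x2 cos_pihalf => e1 e2.
move=> /(le_trans ch); move: e1 e2; rewrite !mulr2n.
set u := cos (pi / 8); set v := cos (pi / 4) => e1 e2 c8.
have h1 : (19 / 20) ^+ 2 <= u ^+ 2 by rewrite ler_sqr // nnegrE; lra.
have h2 : 4 / 5 <= v by lra.
have h3 : (4 / 5) ^+ 2 <= v ^+ 2 by rewrite ler_sqr // nnegrE; lra.
by lra.
Qed.

Lemma polarN (z1 z2 : R) t : polar z1 z2 t -> polar (- z1) (- z2) (t + pi).
Proof. by move=> [r r0 [-> ->]]; exists r => //; rewrite cosDpi sinDpi !mulrN. Qed.

(** Opposite directions put the origin between the two vectors, at a ratio given by their lengths
    [r] and [s]. In contrapositive form, a segment avoiding the origin yields the hypothesis of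
    [cos_neqN1_window]. *)
Lemma polar_antipodal (z1 z2 w1 w2 : R) a b : polar z1 z2 a -> polar w1 w2 b ->
  cos (a - b) = -1 -> exists2 l, 0 <= l <= 1 &
  z1 + l * (w1 - z1) = 0 /\ z2 + l * (w2 - z2) = 0.
Proof.
move=> [r r0 [-> ->]] [s s0 [-> ->]] cab.
have sab : sin (a - b) = 0 by apply: cos1sin0; rewrite cab normrN1.
have ea : a = (a - b) + b by rewrite subrK.
have -> : cos a = - cos b by rewrite ea cosD cab sab; ring.
have -> : sin a = - sin b by rewrite ea sinD cab sab; ring.
exists (r / (r + s)).
  by rewrite ler_pdivlMr ?ler_pdivrMr; lra.
split; field; lra.
Qed.

(** The difference is at most a tenth of the first vector, which expands to
    [99 r^2 + 100 s^2 <= 200 r s cos (a - b)]; a cosine below 19 / 20 would contradict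
    [0 <= (19 r - 20 s)^2]. *)
Lemma polar_near (z1 z2 w1 w2 : R) a b : polar z1 z2 a -> polar w1 w2 b ->
  ((z1 - w1) ^+ 2 + (z2 - w2) ^+ 2) * 100 <= z1 ^+ 2 + z2 ^+ 2 ->
  19 / 20 <= cos (a - b).
Proof.
move=> [r r0 [-> ->]] [s s0 [-> ->]]; rewrite cosB.
have ha := cos2Dsin2 a; have hb := cos2Dsin2 b.
set A := cos a in ha *; set B := sin a in ha *; set C := cos b in hb *; set D :=
  sin b in hb *.
move=> H.
have {}H : 99 * r ^+ 2 + 100 * s ^+ 2 <= 200 * (r * s) * (A * C + B * D).
  have -> : 99 * r ^+ 2 + 100 * s ^+ 2 = 99 * r ^+ 2 * (A ^+ 2 + B ^+ 2) + 100 * s ^+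
    2 * (C ^+ 2 + D ^+ 2).
    by rewrite ha hb; ring.
  by rewrite -subr_ge0; move: H; rewrite -subr_ge0; congr (_ <= _); ring.
have rs : 0 < r * s by rewrite mulr_gt0.
rewrite leNgt; apply/negP => h.
have : 99 * r ^+ 2 + 100 * s ^+ 2 < 200 * (r * s) * (19 / 20).
  by apply: (le_lt_trans H); rewrite ltr_pM2l //; lra.
by have := sqr_ge0 (19 * r - 20 * s); nra.
Qed.

(** At an acute angle the turn is the arctangent of cross product over dot product, which is
    continuous in both vectors; sums of such turns build the lift of [polar_lift]. *)
Lemma polar_step (z1 z2 w1 w2 : R) t : polar z1 z2 t -> 0 < z1 * w1 + z2 * w2 ->
  polar w1 w2 (t + atan ((z1 * w2 - z2 * w1) / (z1 * w1 + z2 * w2))).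
Proof.
move=> [r r0 [-> ->]] d0.
set d := _ + _ in d0 *; set c := r * cos t * w2 - _; set al := atan (c / d).
have ca : 0 < cos al by apply: cos_gt0_pihalf; rewrite atan_gtNpi2 atan_ltpi2.
have sa : sin al = c / d * cos al.
  by rewrite -[c / d]atanK -/al /tan -mulrA mulVf ?mulr1 // gt_eqF.
exists (d / (r * cos al)); first by rewrite divr_gt0 // mulr_gt0.
have h := cos2Dsin2 t.
rewrite cosD sinD sa.
have rc : r * cos al != 0 by rewrite mulf_neq0 // gt_eqF.
split.
- transitivity ((d * cos t - c * sin t) / r); last by field; rewrite !gt_eqF.
  rewrite /d /c; apply: (mulIf (lt0r_neq0 r0)); rewrite divfK ?gt_eqF //.
  transitivity (r * w1 * (cos t ^+ 2 + sin t ^+ 2)); first by rewrite h; ring.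
  by ring.
- transitivity ((d * sin t + c * cos t) / r); last by field; rewrite !gt_eqF.
  rewrite /d /c; apply: (mulIf (lt0r_neq0 r0)); rewrite divfK ?gt_eqF //.
  transitivity (r * w2 * (cos t ^+ 2 + sin t ^+ 2)); first by rewrite h; ring.
  by ring.
Qed.

Lemma polar_exists (z1 z2 : R) : 0 < z1 ^+ 2 + z2 ^+ 2 -> exists t, polar z1 z2 t.
Proof.
move=> H.
have P0 : polar 1 0 0 by exists 1 => //; rewrite cos0 sin0 mulr1 mulr0.
have P1 : polar 0 1 (pi / 2) by exists 1 => //;
  rewrite cos_pihalf sin_pihalf mulr1 mulr0.
case: (ltgtP z1 0) => [z0|z0|z0].
- by eexists; apply: (polar_step (polarN P0)); lra.
- by eexists; apply: (polar_step P0); lra.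
case: (ltgtP z2 0) => [y0|y0|y0].
- by eexists; apply: (polar_step (polarN P1)); lra.
- by eexists; apply: (polar_step P1); lra.
by move: H; rewrite z0 y0; lra.
Qed.

End Angle.

(** * Lifting the argument of a planar map *)

(** Most uses take [g = h + max 0 k] with [h] nonnegative and [k] positive where [h] vanishes: then
    [h < m] forces [k > 0], uniformly on [A]. *)
Lemma compact_pos_lb (R : realType) (T : topologicalType) (A : set T) (g : T -> R) :
  compact A -> {within A, continuous g} -> (forall x, A x -> 0 < g x) ->
  exists2 m, 0 < m & forall x, A x -> m <= g x.
Proof.
move=> cA cg g0; have [->|A0] := eqVneq A set0; first by exists 1.
have [c /set_mem Ac cmin] := compact_EVT_min ((set0P _).1 A0) cA cg.
by exists (g c) => [|x Ax]; [exact: g0|apply: cmin; exact: mem_set].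
Qed.

Lemma continuous_compT (T U V : topologicalType) (f : T -> U) (g : U -> V) :
  continuous f -> continuous g -> continuous (fun x => g (f x)).
Proof. by move=> cf cg x; apply: continuous_comp; [exact: cf|exact: cg]. Qed.

Lemma continuous_pair (T U V : topologicalType) (f : T -> U) (g : T -> V) :
  continuous f -> continuous g -> continuous (fun x => (f x, g x)).
Proof. by move=> cf cg x; apply: cvg_pair; [exact: cf|exact: cg]. Qed.

Lemma continuous_max0 (R : realType) (T : topologicalType) (f : T -> R) :
  continuous f -> continuous (fun x => Num.max 0 (f x)).
Proof.
move=> cf; have -> : (fun x => Num.max 0 (f x)) = (fun x => (f x + `|f x|) / 2).
  by apply/funext => x; rewrite maxr_absE !add0r normrN.
move=> x; apply: cvgMl; apply: cvgD; [exact: cf|by apply: cvg_norm; exact: cf].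
Qed.

Section Lift.
Variables (R : realType) (G1 G2 : R * R -> R) (A : R).
Hypotheses (cG1 : continuous G1) (cG2 : continuous G2) (A0 : 0 < A).
Hypothesis G_neq0 : forall z, 0 < G1 z ^+ 2 + G2 z ^+ 2.

Let scl (l : R) (z : R * R) : R * R := (l * z.1, l * z.2).
Let dotG (z w : R * R) : R := G1 z * G1 w + G2 z * G2 w.
Let crossG (z w : R * R) : R := G1 z * G2 w - G2 z * G1 w.

(** Retracting the plane onto the square makes the lift continuous on the whole plane, while the
    uniform estimates come from the compact square. *)
Let clampR (x : R) : R := Num.max 0 (Num.min A x).
Let clamp (z : R * R) : R * R := (clampR z.1, clampR z.2).

Local Lemma cont_dotG (T : topologicalType) (f g : T -> R * R) :
  continuous f -> continuous g -> continuous (fun x => dotG (f x) (g x)).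
Proof.
move=> cf cg x; apply: cvgD; apply: cvgM;
  first [exact: (continuous_compT cf cG1)|exact: (continuous_compT cg cG1)|
    exact: (continuous_compT cf cG2)|exact: (continuous_compT cg cG2)].
Qed.

Local Lemma cont_crossG (T : topologicalType) (f g : T -> R * R) :
  continuous f -> continuous g -> continuous (fun x => crossG (f x) (g x)).
Proof.
move=> cf cg x; apply: cvgB; apply: cvgM;
  first [exact: (continuous_compT cf cG1)|exact: (continuous_compT cg cG1)|
    exact: (continuous_compT cf cG2)|exact: (continuous_compT cg cG2)].
Qed.

Local Lemma cont_scl (T : topologicalType) (l : T -> R) (f : T -> R * R) :
  continuous l -> continuous f -> continuous (fun x => scl (l x) (f x)).
Proof.
move=> cl cf; apply: continuous_pair => x; apply: cvgM; first exact: cl.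
- by apply: (continuous_compT cf) => z; exact: cvg_fst.
- exact: cl.
- by apply: (continuous_compT cf) => z; exact: cvg_snd.
Qed.

Local Lemma cont_clamp : continuous clamp.
Proof.
have H : continuous clampR.
  move=> x; rewrite /clampR; apply: continuous_max; first exact: cst_continuous.
  apply: continuous_min; [exact: cst_continuous|exact: cvg_id].
by apply: continuous_pair; apply: continuous_compT H => x;
  [exact: cvg_fst|exact: cvg_snd].
Qed.

Local Lemma clamp_id (x y : R) : 0 <= x <= A -> 0 <= y <= A -> clamp (x, y) = (x, y).
Proof.
have H z : 0 <= z <= A -> clampR z = z.
  by move=> /andP[z0 zA]; rewrite /clampR min_r // max_r.
by move=> hx hy; rewrite /clamp /= !H.
Qed.

Local Lemma small_step : exists2 m : R, 0 < m &
  forall z (l k : R), 0 <= l <= 1 -> 0 <= k <= 1 -> `|l - k| < m ->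
  0 < dotG (scl l (clamp z)) (scl k (clamp z)).
Proof.
pose g (q : (R * R) * (R * R)) := `|q.2.1 - q.2.2| +
  Num.max 0 (dotG (scl q.2.1 q.1) (scl q.2.2 q.1)).
pose K : set ((R * R) * (R * R)) := (`[0, A] `*` `[0, A]) `*` (`[0, 1] `*` `[0, 1]).
have cK : compact K.
  by do 2![apply: compact_setX]; exact: segment_compact.
have cfst (T U : topologicalType) : continuous (@fst T U) by move=> ?; exact: cvg_fst.
have csnd (T U : topologicalType) : continuous (@snd T U) by move=> ?; exact: cvg_snd.
have c21 : continuous (fun q : (R * R) * (R * R) => q.2.1).
  by apply: continuous_compT (cfst _ _); exact: csnd.
have c22 : continuous (fun q : (R * R) * (R * R) => q.2.2).
  by apply: continuous_compT (csnd _ _); exact: csnd.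
have cmx : continuous (fun q : (R * R) * (R * R) =>
    Num.max 0 (dotG (scl q.2.1 q.1) (scl q.2.2 q.1))).
  apply: continuous_max0; apply: cont_dotG; apply: cont_scl => //; exact: cfst.
have cg : continuous g.
  move=> q; apply: cvgD; last exact: cmx.
  by apply: cvg_norm; apply: cvgB; [exact: c21|exact: c22].
have [|m m0 H] := compact_pos_lb cK (continuous_subspaceT cg).
  move=> [z [l k]] _; rewrite /g /=; have [->|lk] := eqVneq l k.
    by rewrite subrr normr0 add0r lt_max /dotG -!expr2 G_neq0 orbT.
  by apply: ltr_wpDr; [rewrite le_max lexx|rewrite normr_gt0 subr_eq0].
exists m => // z l k hl hk lk.
have clA x : clampR x \in `[0,
  A] by rewrite in_itv /= le_max lexx /= ge_max ge_min lexx (ltW A0).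
have /H : K (clamp z, (l, k)).
  by split; split => /=; rewrite ?in_itv //=; exact: clA.
by rewrite /g /=; case: leP => [h|//]; rewrite addr0 leNgt lk.
Qed.

(** The angle at [z] is obtained from one at the origin by going along the ray to [z] in [M] equal
    steps and adding the turns of [polar_step]. As [M] does not depend on [z], the sum is continuous
    in [z]. *)
Lemma polar_lift : exists2 th : R * R -> R, continuous th &
  forall x y, 0 <= x <= A -> 0 <= y <= A -> polar (G1 (x, y)) (G2 (x, y)) (th (x, y)).
Proof.
have [m m0 step] := small_step.
have [t0 pt0] := polar_exists (G_neq0 (0, 0)).
pose M := (Num.trunc m^-1).+1.
have M0 : 0 < (M%:R : R) by rewrite ltr0n.
have Mm : M%:R^-1 < m by rewrite invf_plt ?posrE // truncnS_gt.
pose P (k : nat) (z : R * R) : R * R := scl (k%:R / M%:R) (clamp z).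
pose Q k (z : R * R) := atan (crossG (P k z) (P k.+1 z) / dotG (P k z) (P k.+1 z)).
have st k z : (k < M)%N -> 0 < dotG (P k z) (P k.+1 z).
  move=> kM; apply: step.
  - by rewrite divr_ge0 //= ler_pdivrMr // mul1r ler_nat ltnW.
  - by rewrite divr_ge0 //= ler_pdivrMr // mul1r ler_nat.
  - by rewrite -mulrBl -natr1 opprD addNKr mulN1r normrN gtr0_norm // invr_gt0.
have cP k : continuous (P k).
  by apply: cont_scl; [move=> x; exact: cst_continuous|exact: cont_clamp].
have cQ k : (k < M)%N -> continuous (Q k).
  move=> kM; apply: continuous_compT (@continuous_atan R) => z.
  apply: cvgM; first exact: cont_crossG.
  by apply: cvgV; [rewrite gt_eqF // st|exact: cont_dotG].
have cS k : (k <= M)%N -> continuous (fun z => \sum_(i < k) Q i z).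
  elim: k => [_|k IH kM].
    under [X in continuous X]eq_fun do rewrite big_ord0.
    by move=> z; exact: cst_continuous.
  under [X in continuous X]eq_fun do rewrite big_ord_recr /=.
  by move=> z; apply: cvgD; [apply: IH; exact: ltnW|exact: cQ].
exists (fun z => t0 + \sum_(k < M) Q k z).
  move=> z; apply: cvgD; first exact: cst_continuous.
  exact: cS.
move=> x y hx hy.
have H k : (k <= M)%N -> polar (G1 (P k (x, y))) (G2 (P k (x, y))) (t0 +
  \sum_(i < k) Q i (x, y)).
  elim: k => [_|k IH kM].
    by rewrite big_ord0 addr0 /P /scl !mul0r.
  by rewrite big_ord_recr /= addrA; apply: polar_step (IH (ltnW kM)) (st _ _ kM).
move: (H M (leqnn _)); rewrite /P /scl divff ?gt_eqF // !mul1r clamp_id //.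
Qed.

End Lift.

(** * Winding numbers of a loop closed by a segment *)

Section Window.
Variable R : realType.

Lemma window_uniq (m n : int) : `|pi * m%:~R - pi * n%:~R| < pi :> R -> m = n.
Proof.
rewrite -mulrBr normrM (gtr0_norm (@pi_gt0 R)) gtr_pMr ?pi_gt0 // -intrB.
by rewrite -intr_norm -[1]/(1%:~R) ltr_int; lia.
Qed.

Lemma cos_near_window (f : R -> R) a b : a <= b -> continuous f ->
  (forall x, a <= x <= b -> 19 / 20 <= cos (f x)) ->
  exists n : int, forall x, a <= x <= b -> `|f x - 2 * pi * n%:~R| < pi / 8.
Proof.
move=> ab cf H; have [|n Hn] := cos_neqN1_window ab cf.
  by move=> x /H h e; move: h; rewrite e; lra.
by exists n => x hx; apply: cos_ge_near; [exact: Hn|exact: H].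
Qed.

End Window.

Section PlanarCurve.
Variables (R : realType) (p : R -> R * R).
Implicit Types (s t u v al be : R).

Definition sqdist s t : R := ((p s).1 - (p t).1) ^+ 2 + ((p s).2 - (p t).2) ^+ 2.

Definition chord_angle s t al := polar ((p s).1 - (p t).1) ((p s).2 - (p t).2) al.

Definition on_chord s a b := exists2 l : R, 0 <= l <= 1 &
  (p s).1 = (p a).1 + l * ((p b).1 - (p a).1) /\
  (p s).2 = (p a).2 + l * ((p b).2 - (p a).2).

Lemma sqdistC s t : sqdist s t = sqdist t s.
Proof. by rewrite /sqdist; ring. Qed.

Lemma sqdist_ge0 s t : 0 <= sqdist s t.
Proof. by rewrite addr_ge0 // sqr_ge0. Qed.

Lemma sqdist_gt0 s t : injective p -> s != t -> 0 < sqdist s t.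
Proof.
move=> inj_p st; rewrite lt0r sqdist_ge0 andbT; apply: contra st.
rewrite paddr_eq0 ?sqr_ge0 // !sqrf_eq0 !subr_eq0 => /andP[/eqP h1 /eqP h2].
by apply/eqP/inj_p; rewrite (surjective_pairing (p s)) h1 h2 -surjective_pairing.
Qed.

Lemma sqdist_tri s t u : sqdist s u <= 2 * (sqdist s t + sqdist t u).
Proof.
have h1 := sqr_ge0 ((p s).1 - (p t).1 - ((p t).1 - (p u).1)).
have h2 := sqr_ge0 ((p s).2 - (p t).2 - ((p t).2 - (p u).2)).
by rewrite /sqdist; lra.
Qed.

Lemma sqdist_tri3 s t u v : sqdist s v <= 3 * (sqdist s t + sqdist t u + sqdist u v).
Proof.
have h1 := sqr_ge0 ((p s).1 - (p t).1 - ((p t).1 - (p u).1)).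
have h2 := sqr_ge0 ((p s).2 - (p t).2 - ((p t).2 - (p u).2)).
have h3 := sqr_ge0 ((p s).1 - (p t).1 - ((p u).1 - (p v).1)).
have h4 := sqr_ge0 ((p s).2 - (p t).2 - ((p u).2 - (p v).2)).
have h5 := sqr_ge0 ((p t).1 - (p u).1 - ((p u).1 - (p v).1)).
have h6 := sqr_ge0 ((p t).2 - (p u).2 - ((p u).2 - (p v).2)).
by rewrite /sqdist; lra.
Qed.

Lemma chord_angleN s t al : chord_angle s t al -> chord_angle t s (al + pi).
Proof. by move=> /polarN; rewrite !opprB. Qed.

Lemma chord_angle_near_r s t r al be : chord_angle s t al -> chord_angle s r be ->
  sqdist t r * 100 <= sqdist s t -> 19 / 20 <= cos (al - be).
Proof.
move=> h1 h2 h; apply: (polar_near h1 h2); move: h; rewrite /sqdist => h.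
by move: h; rewrite -subr_ge0 => h; rewrite -subr_ge0; congr (_ <= _): h; ring.
Qed.

Lemma chord_angle_near_l s t r al be : chord_angle s t al -> chord_angle r t be ->
  sqdist s r * 100 <= sqdist s t -> 19 / 20 <= cos (al - be).
Proof.
move=> /chord_angleN h1 /chord_angleN h2; rewrite (sqdistC s t) => h.
by have := chord_angle_near_r h1 h2 h; rewrite opprD addrACA subrr addr0.
Qed.

Lemma chord_angle_chord_r s a b al be : chord_angle s a al -> chord_angle s b be ->
  ~ on_chord s a b -> cos (al - be) <> -1.
Proof.
move=> h1 h2 ns cN; apply: ns.
have [l l01 [e1 e2]] := polar_antipodal h1 h2 cN.
by exists l => //; split; lra.
Qed.

Lemma chord_angle_chord_l s a b al be : chord_angle a s al -> chord_angle b s be ->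
  ~ on_chord s a b -> cos (al - be) <> -1.
Proof.
move=> /chord_angleN h1 /chord_angleN h2 ns; have := chord_angle_chord_r h1 h2 ns.
by rewrite opprD addrACA subrr addr0.
Qed.

Lemma angle_lift (tau A : R) : continuous p -> injective p -> 0 < tau -> 0 < A ->
  exists th : R -> R -> R,
  (forall f g : R -> R, continuous f -> continuous g ->
    continuous (fun x => th (f x) (g x))) /\
  (forall s t, 0 <= s -> s + tau <= t -> t <= A -> chord_angle t s (th t s)).
Proof.
move=> cp inj_p tau0 A0.
have cf : continuous (@fst R R) by move=> z; exact: cvg_fst.
have cs : continuous (@snd R R) by move=> z; exact: cvg_snd.
have c2 : continuous (fun z : R * R => z.1 + tau + `|z.2|).
  move=> z; apply: cvgD; first by apply: cvgD; [exact: cf|exact: cst_continuous].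
  by apply: cvg_norm; exact: cvg_snd.
(* The absolute value keeps the two times at least [tau] apart everywhere, so the difference has no
   zero on the plane. A pair of times [s], [t] has coordinates [s] and [t - s - tau]. *)
pose G (q : R -> R) (z : R * R) := q (z.1 + tau + `|z.2|) - q z.1.
have cG q : continuous q -> continuous (G q).
  by move=> cq z; apply: cvgB;
    [exact: (continuous_compT c2 cq)|exact: (continuous_compT cf cq)].
have G0 z : 0 < G (fst \o p) z ^+ 2 + G (snd \o p) z ^+ 2.
  apply: (@sqdist_gt0 (z.1 + tau + `|z.2|) z.1) => //.
  by have h := normr_ge0 z.2; rewrite gt_eqF //; lra.
have [L cL HL] := polar_lift (cG _ (continuous_compT cp cf))
  (cG _ (continuous_compT cp cs)) A0 G0.
exists (fun t s => L (s, t - s - tau)); split.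
  move=> f g hf hg; apply: continuous_compT cL; apply: (continuous_pair hg) => x.
  by apply: cvgB; last exact: cst_continuous; apply: cvgB; [exact: hf|exact: hg].
move=> s t s0 st tA.
have := HL s (t - s - tau); rewrite /G /= ger0_norm ?subr_ge0; last lra.
have -> : s + tau + (t - s - tau) = t by ring.
by apply; lra.
Qed.

End PlanarCurve.

(** The configuration to be excluded. Around the times [a] and [b] the curve follows its piece
    around time 1 up to [eps], whereas points of the initial piece at times [tau] apart keep a
    squared distance of at least [c]. The factor 2000 leaves room for the factor 100 of [polar_near]
    after the triangle inequalities. *)
Record parallel_gap (R : realType) (p : R -> R * R) (tau eps c a b S : R) : Prop :=
  ParallelGap {
    gap_tau : 8 * tau = 1;
    gap_a : 1 / 2 <= a;
    gap_ab : a + 3 * tau <= b;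
    gap_bS : b + tau <= S;
    gap_c : 0 < c;
    gap_eps : 0 <= eps;
    gap_eps_c : 2000 * eps <= c;
    gap_strand_a : forall u, `|u| <= 1 / 2 -> sqdist p (a + u) (1 + u) <= eps;
    gap_strand_b : forall u, `|u| <= 1 / 2 -> sqdist p (b + u) (1 + u) <= eps;
    gap_sep : forall s t : R, 0 <= s <= 2 -> 0 <= t <= 2 -> tau <= `|s - t| ->
      c <= sqdist p s t;
    gap_free : forall s : R, 0 <= s <= S -> s != a -> s != b -> ~ on_chord p s a b;
    gap_0S_free : forall s : R, a <= s <= b -> ~ on_chord p s 0 S;
    gap_0S_near : sqdist p 0 S <= eps }.

Tactic Notation "lra_with" ne_hyp_list(H) := clear - H; lra.

(** Both points lie within [eps] of the piece around time 1, at the offsets [u] and [v], where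
    [gap_sep] applies; the 3 comes from [sqdist_tri3]. *)
Lemma strand_far (R : realType) (p : R -> R * R) (tau eps c a b S : R)
  (gap : parallel_gap p tau eps c a b S) s t u v :
  (s = a \/ s = b) -> (t = a \/ t = b) ->
  `|u| <= 1 / 2 -> `|v| <= 1 / 2 -> tau <= `|u - v| ->
  c / 3 - 2 * eps <= sqdist p (s + u) (t + v).
Proof.
move: (gap_tau gap) (gap_a gap) (gap_ab gap) (gap_bS gap) (gap_c gap) (gap_eps gap)
  (gap_eps_c gap) (gap_0S_near gap) => hT hA hAB hBS hC hE hEC hN.
move=> hs ht hu hv uv.
have h1 : sqdist p (1 + u) (s + u) <= eps by rewrite sqdistC; case: hs => ->;
  [exact: (gap_strand_a gap)|exact: (gap_strand_b gap)].
have h2 : sqdist p (t + v) (1 + v) <= eps by case: ht => ->;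
  [exact: (gap_strand_a gap)|exact: (gap_strand_b gap)].
have : c <= sqdist p (1 + u) (1 + v).
  move: hu hv; rewrite !ler_norml => /andP[u1 u2] /andP[v1 v2].
  by apply: (gap_sep gap); [lra|lra|rewrite opprD addrACA subrr add0r].
have := sqdist_tri3 p (1 + u) (s + u) (t + v) (1 + v).
by lra.
Qed.

Lemma strand_near (R : realType) (p : R -> R * R) (tau eps c a b S : R)
  (gap : parallel_gap p tau eps c a b S) v :
  `|v| <= 1 / 2 -> sqdist p (a + v) (b + v) <= 4 * eps.
Proof.
move: (gap_tau gap) (gap_a gap) (gap_ab gap) (gap_bS gap) (gap_c gap) (gap_eps gap)
  (gap_eps_c gap) (gap_0S_near gap) => hT hA hAB hBS hC hE hEC hN.
move=> hv; have h1 := gap_strand_a gap hv; have := gap_strand_b gap hv;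
  rewrite (sqdistC p) => h2.
by have := sqdist_tri p (a + v) (1 + v) (b + v); lra.
Qed.

Lemma strand_far_start (R : realType) (p : R -> R * R) (tau eps c a b S : R)
  (gap : parallel_gap p tau eps c a b S) s :
  (s = a \/ s = b) -> c / 2 - eps <= sqdist p s 0.
Proof.
move: (gap_tau gap) (gap_a gap) (gap_ab gap) (gap_bS gap) (gap_c gap) (gap_eps gap)
  (gap_eps_c gap) (gap_0S_near gap) => hT hA hAB hBS hC hE hEC hN.
move=> hs; have h0 : `|0 : R| <= 1 / 2 by rewrite normr0; lra.
have h1 : sqdist p 1 s <= eps.
  by rewrite (sqdistC p) -[s]addr0 -[1]addr0; case: hs => ->;
    [exact: (gap_strand_a gap)|exact: (gap_strand_b gap)].
have : c <= sqdist p 1 0.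
  by apply: (gap_sep gap); rewrite ?subr0 ?normr1; lra.
by have := sqdist_tri p 1 s 0; lra.
Qed.

(** Each combination of values of [th] below is confined near a multiple of [2 pi] or near another
    combination. Linear relations among angles thus become relations among integers, and the last
    one contradicts parity. *)
Lemma no_parallel_gap (R : realType) (p : R -> R * R) (tau eps c a b S : R)
  (gap : parallel_gap p tau eps c a b S) : continuous p -> injective p -> False.
Proof.
move: (gap_tau gap) (gap_a gap) (gap_ab gap) (gap_bS gap) (gap_c gap) (gap_eps gap)
  (gap_eps_c gap) (gap_0S_near gap) => hT hA hAB hBS hC hE hEC hN.
move=> cp inj_p.
have tau0 : 0 < tau by lra.
have pi0 := @pi_gt0 R.
have S0 : 0 < S by lra.
have [th [cth Hth]] := angle_lift cp inj_p tau0 S0.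
have cid : continuous (fun x : R => x) by move=> x; exact: cvg_id.
have cc (x : R) : continuous (fun _ : R => x) by move=> y; exact: cst_continuous.
have cadd (x : R) : continuous (fun u : R => x + u).
  by move=> y; apply: cvgD; [exact: cc|exact: cid].
have csub (f g : R -> R) : continuous f -> continuous g ->
  continuous (fun x => f x - g x).
  by move=> cf cg x; apply: cvgB; [exact: cf|exact: cg].
have near_ab v : `|v| <= 1 / 2 -> sqdist p (a + v) (b + v) <= 4 * eps.
  exact: (strand_near gap).
have Ntau0 : - tau <= 0 by lra.
have n0 : `|0 : R| <= 1 / 2 by rewrite normr0; lra.
have dab : sqdist p a b <= 4 * eps by have := near_ab 0 n0; rewrite !addr0.
have ntau : `|tau| <= 1 / 2 by rewrite ger0_norm; lra_with hT tau0.
have nNtau : `|- tau| <= 1 / 2 by rewrite normrN.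
have fa0 := strand_far_start gap (or_introl erefl : a = a \/ a = b).
have aa : a = a \/ a = b by left.
have bb : b = a \/ b = b by right.
have tau_n (u v : R) : tau <= u - v -> tau <= `|u - v|.
  by move=> h; apply: le_trans h (ler_norm _).
(* [N] is minus the winding number of the loop around the points before [a - tau]. *)
pose k1 s := th a s - th b s.
have [N HN] : exists n : int, forall s, 0 <= s <= a - tau -> `|k1 s - 2 * pi * n%:~R|
  < pi.
  apply: cos_neqN1_window; [lra_with hT hA hAB hBS|by apply: csub; exact: cth|].
  move=> s hs; apply: (@chord_angle_chord_l R p s a b); [apply: Hth;
    lra_with hT hA hAB hBS hs|apply: Hth; lra_with hT hA hAB hBS hs|].
  by apply: (gap_free gap); [lra_with hT hA hAB hBS hs|rewrite lt_eqF;
    lra_with hT hA hAB hBS hs|rewrite lt_eqF; lra_with hT hA hAB hBS hs].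
(* Seen from [p 0], far from both strands, the short chord from [p a] to [p b] subtends a small
   angle. *)
have k1_0 : `|k1 0 - 2 * pi * N%:~R| < pi / 8.
  apply: cos_ge_near; first by apply: HN; lra_with hT hA hAB hBS.
  by apply: (@chord_angle_near_l R p a 0 b); [apply: Hth;
    lra_with hT hA hAB hBS|apply: Hth;
      lra_with hT hA hAB hBS|lra_with hC hE hEC dab fa0].
have k1_a : `|k1 (a - tau) - 2 * pi * N%:~R| < pi / 8.
  apply: cos_ge_near; first by apply: HN; lra_with hT hA hAB hBS.
  apply: (@chord_angle_near_l R p a (a - tau) b); [apply: Hth;
    lra_with hT hA hAB hBS|apply: Hth; lra_with hT hA hAB hBS|].
  have := strand_far gap aa aa n0 nNtau; rewrite addr0 opprK add0r => /(_ (ler_norm _)).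
  by lra_with hC hE hEC dab.
(* [N'] is minus the winding number around the points after [b + tau]. *)
pose k2 s := th s a - th s b.
have [N' HN'] : exists n : int, forall s, b + tau <= s <= S -> `|k2 s - 2 * pi * n%:~R|
  < pi.
  apply: cos_neqN1_window; [lra_with hT hA hAB hBS|by apply: csub; exact: cth|].
  move=> s hs; apply: (@chord_angle_chord_r R p s a b); [apply: Hth;
    lra_with hT hA hAB hBS hs|apply: Hth; lra_with hT hA hAB hBS hs|].
  by apply: (gap_free gap); [lra_with hT hA hAB hBS hs|rewrite gt_eqF;
    lra_with hT hA hAB hBS hs|rewrite gt_eqF; lra_with hT hA hAB hBS hs].
have k2_S : `|k2 S - 2 * pi * N'%:~R| < pi / 8.
  apply: cos_ge_near; first by apply: HN'; lra_with hT hA hAB hBS.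
  apply: (@chord_angle_near_r R p S a b); [apply: Hth;
    lra_with hT hA hAB hBS|apply: Hth; lra_with hT hA hAB hBS|].
  by have := sqdist_tri p a S 0; rewrite (sqdistC p a S) (sqdistC p S 0); move: hN;
    lra_with hC hE hEC dab fa0.
have k2_b : `|k2 (b + tau) - 2 * pi * N'%:~R| < pi / 8.
  apply: cos_ge_near; first by apply: HN'; lra_with hT hA hAB hBS.
  apply: (@chord_angle_near_r R p (b + tau) a b); [apply: Hth;
    lra_with hT hA hAB hBS|apply: Hth; lra_with hT hA hAB hBS|].
  have := strand_far gap bb aa ntau n0; rewrite addr0 subr0 => /(_ (ler_norm _)).
  by lra_with hC hE hEC dab.
(* For [t] in [[a, b]] the directions from [p 0] and from [p S] to [p t] are never opposite.
   Comparing the two ends, where [k3 a - k3 b = k1 0 - k2 S], gives [N = N']. *)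
pose k3 t := th t 0 - (th S t + pi).
have [n3 Hn3] : exists n : int, forall t, a <= t <= b -> `|k3 t - 2 * pi * n%:~R| < pi.
  apply: cos_neqN1_window; [lra_with hT hA hAB hBS| |].
    apply: csub; first exact: cth.
    by move=> x; apply: cvgD; [exact: cth|exact: cc].
  move=> t ht; apply: (@chord_angle_chord_r R p t 0 S).
  - by apply: Hth; lra_with hT hA hAB hBS ht.
  - by apply: chord_angleN; apply: Hth; lra_with hT hA hAB hBS ht.
  - exact: (gap_0S_free gap).
have k3_end t : (t = a \/ t = b) -> `|k3 t - 2 * pi * n3%:~R| < pi / 8.
  move=> ht; apply: cos_ge_near; first by case: ht => ht; apply: Hn3;
    lra_with hT hA hAB hBS ht.
  apply: (@chord_angle_near_r R p t 0 S).
  - by case: ht => ht; apply: Hth; lra_with hT hA hAB hBS ht.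
  - by case: ht => ht; apply: chord_angleN; apply: Hth; lra_with hT hA hAB hBS ht.
  - by have := strand_far_start gap ht; lra_with hC hE hEC hN.
have NN : N = N'.
  have := k3_end _ aa; have := k3_end _ bb; move: k1_0 k2_S.
  by rewrite /k1 /k2 /k3 !ltr_norml => h1 h2 h3 h4; apply: (@window_uniq R);
    rewrite ltr_norml; clear - pi0 h1 h2 h3 h4; lra.
(* Along the loop the segment is not crossed, so that the rotations seen from
   its two ends agree. *)
pose k4 t := th t a - (th b t + pi).
have [n4 Hn4] : exists n : int, forall t, a + tau <= t <= b - tau ->
  `|k4 t - 2 * pi * n%:~R| < pi.
  apply: cos_neqN1_window; [lra_with hT hA hAB hBS| |].
    apply: csub; first exact: cth.
    by move=> x; apply: cvgD; [exact: cth|exact: cc].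
  move=> t ht; apply: (@chord_angle_chord_r R p t a b).
  - by apply: Hth; lra_with hT hA hAB hBS ht.
  - by apply: chord_angleN; apply: Hth; lra_with hT hA hAB hBS ht.
  - by apply: (gap_free gap); [lra_with hT hA hAB hBS ht|rewrite gt_eqF;
      lra_with hT hA hAB hBS ht|rewrite lt_eqF; lra_with hT hA hAB hBS ht].
have k4_end t : t = a + tau \/ t = b - tau -> `|k4 t - 2 * pi * n4%:~R| < pi / 8.
  move=> ht; apply: cos_ge_near; first by case: ht => ht; apply: Hn4;
    lra_with hT hA hAB hBS ht.
  apply: (@chord_angle_near_r R p t a b).
  - by case: ht => ht; apply: Hth; lra_with hT hA hAB hBS ht.
  - by case: ht => ht; apply: chord_angleN; apply: Hth; lra_with hT hA hAB hBS ht.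
  - have h1 := strand_far gap aa aa ntau n0; have h2 := strand_far gap bb aa nNtau n0.
    move: h1 h2; rewrite addr0 !subr0 normrN => /(_ (ler_norm _)) h1 /(_ (ler_norm _))
      h2.
    by case: ht => ->; move: dab; lra_with hC hE hEC h1 h2.
have k4_a := k4_end _ (or_introl erefl); have {k4_end} k4_b :=
  k4_end _ (or_intror erefl).
(* Chords joining the strands at equal offsets are short compared with the distance to a point whose
   offset is larger by [tau]. *)
have band u v : - tau <= u <= tau -> - tau <= v <= tau -> tau <= u - v ->
   forall s, s = a \/ s = b ->
   sqdist p (a + v) (b + v) * 100 <= sqdist p (s + u) (a + v).
  move=> hu hv uv s hs.
  have hu2 : `|u| <= 1 / 2 by rewrite ler_norml; lra_with hT hu.
  have hv2 : `|v| <= 1 / 2 by rewrite ler_norml; lra_with hT hv.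
  have := near_ab v hv2; have := strand_far gap hs aa hu2 hv2 (tau_n _ _ uv).
  by lra_with hC hE hEC uv.
(* First the upper time moves from [b] to [b + tau], then the offset of the two lower ones from
   [- tau] to 0. In this order the times stay [tau] apart, in the domain of [th]. *)
have E5 : `|th b (a - tau) - th b (b - tau) - (th (b + tau) a - th (b + tau) b)|
  < pi / 4.
  pose k u := th (b + u) (a - tau) - th (b + u) (b - tau).
  pose k' v := th (b + tau) (a + v) - th (b + tau) (b + v).
  have A1 u : 0 <= u <= tau -> 19 / 20 <= cos (k u).
    move=> hu; apply: (@chord_angle_near_r R p (b + u) (a - tau) (b - tau));
      [apply: Hth; lra_with hT hA hAB hBS hu|apply: Hth; lra_with hT hA hAB hBS hu|].
    by apply: band => //; lra_with hT hA hAB hBS hu.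
  have A2 v : - tau <= v <= 0 -> 19 / 20 <= cos (k' v).
    move=> hv; apply: (@chord_angle_near_r R p (b + tau) (a + v) (b + v)); [apply: Hth;
      lra_with hT hA hAB hBS hv|apply: Hth; lra_with hT hA hAB hBS hv|].
    by apply: band => //; lra_with hT hA hAB hBS hv.
  have [m B] := cos_near_window (ltW tau0) (csub _ _ (cth _ _ (cadd _) (cc _)) (cth _ _
    (cadd _) (cc _))) A1.
  have [m' B'] := cos_near_window Ntau0 (csub _ _ (cth _ _ (cc _) (cadd _)) (cth _ _
    (cc _) (cadd _))) A2.
  have mm : m = m'.
    have := B tau ltac:(lra_with tau0); have := B' (- tau) ltac:(lra_with tau0).
    by rewrite /k /k' !ltr_norml => h1 h2; apply: (@window_uniq R); rewrite ltr_norml;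
      clear - pi0 h1 h2; lra.
  have := B 0 ltac:(lra_with tau0); have := B' 0 ltac:(lra_with tau0);
    rewrite -mm /k /k' !addr0 !ltr_norml; clear - pi0; lra.
have [j E6 E6'] : exists2 j : int, `|th (b - tau) a - (th a (a - tau) +
  pi) - 2 * pi * j%:~R| < pi / 8 &
   `|th (b - tau) a - (th a (a - tau) + pi) - (th b (a + tau) - (th (a + tau) a + pi))|
     < pi / 4.
  pose k v := th (b - tau) (a + v) - (th (a + v) (a - tau) + pi).
  pose k' u := th (b + u) (a + tau) - (th (a + tau) (a + u) + pi).
  have A1 v : 0 <= v <= tau -> 19 / 20 <= cos (k v).
    move=> hv; rewrite /k -cosN opprB.
    apply: (@chord_angle_near_l R p (a - tau) (a + v) (b - tau)); [apply: chord_angleN;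
      apply: Hth; lra_with hT hA hAB hBS hv|apply: Hth; lra_with hT hA hAB hBS hv|].
    have := near_ab _ nNtau; have hv2 : `|v| <= 1 / 2 by rewrite ler_norml;
      lra_with hT hv.
    have := strand_far gap aa aa hv2 nNtau (tau_n v (- tau) ltac:(lra_with hv)).
    by rewrite (sqdistC p (a + v)); lra_with hC hE hEC hv.
  have A2 u : - tau <= u <= 0 -> 19 / 20 <= cos (k' u).
    move=> hu; rewrite /k' -cosN opprB.
    apply: (@chord_angle_near_l R p (a + u) (a + tau) (b + u)); [apply: chord_angleN;
      apply: Hth; lra_with hT hA hAB hBS hu|apply: Hth; lra_with hT hA hAB hBS hu|].
    have hu2 : `|u| <= 1 / 2 by rewrite ler_norml; lra_with hT hu.
    have := near_ab _ hu2.
    have := strand_far gap aa aa ntau hu2 (tau_n tau u ltac:(lra_with hu)).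
    by rewrite (sqdistC p (a + tau)); lra_with hC hE hEC hu.
  have cpi (f : R -> R) : continuous f -> continuous (fun x => f x + pi).
    by move=> cf x; apply: cvgD; [exact: cf|exact: cc].
  have [m B] := cos_near_window (ltW tau0)
    (csub _ _ (cth _ _ (cc _) (cadd _)) (cpi _ (cth _ _ (cadd _) (cc _)))) A1.
  have [m' B'] := cos_near_window Ntau0
    (csub _ _ (cth _ _ (cadd _) (cc _)) (cpi _ (cth _ _ (cc _) (cadd _)))) A2.
  have mm : m = m'.
    have := B tau ltac:(lra_with tau0); have := B' (- tau) ltac:(lra_with tau0).
    by rewrite /k /k' !ltr_norml => h1 h2; apply: (@window_uniq R); rewrite ltr_norml;
      clear - pi0 h1 h2; lra.
  have := B 0 ltac:(lra_with tau0); have := B' 0 ltac:(lra_with tau0);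
    rewrite -mm /k /k' !addr0 => h1 h2.
  by exists m => //; move: h1 h2; rewrite !ltr_norml; clear - pi0; lra.
(* Half the rotation of the curve between its strands is [- 2 pi N] by the winding
   numbers, and [pi (1 + 2 j)] since the chords at the two strands are opposite. *)
have E : 1 + 2 * j = - 2 * N; last by clear - E; lia.
apply: (@window_uniq R); move: k1_a k2_b k4_a k4_b E5 E6 E6'.
rewrite -NN /k1 /k2 /k4 !ltr_norml rmorphD !rmorphM /= rmorphN => h1 h2 h3 h4 h5 h6 h7.
by clear - pi0 h1 h2 h3 h4 h5 h6 h7; apply/andP; split; lra.
Qed.

(** * Recurrent injective curves in the plane *)

Lemma continuous_plane_sqdist (R : realType) (T : topologicalType) (f g : T -> R * R) :
  continuous f -> continuous g ->
  continuous (fun x => ((f x).1 - (g x).1) ^+ 2 + ((f x).2 - (g x).2) ^+ 2).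
Proof.
move=> cf cg.
have c1 : continuous (@fst R R) by move=> z; exact: cvg_fst.
have c2 : continuous (@snd R R) by move=> z; exact: cvg_snd.
have f1 := continuous_compT cf c1; have f2 := continuous_compT cf c2.
have g1 := continuous_compT cg c1; have g2 := continuous_compT cg c2.
by move=> x; apply: cvgD; rewrite !expr2; apply: cvgM; apply: cvgB;
  first [exact: f1|exact: f2|exact: g1|exact: g2].
Qed.

Section RecurrentCurve.
Variable R : realType.
Implicit Types (p : R -> R * R) (a b s t u l : R).

Lemma chord_sqdist_l p s a b l :
  (p s).1 = (p a).1 + l * ((p b).1 - (p a).1) ->
  (p s).2 = (p a).2 + l * ((p b).2 - (p a).2) ->
  sqdist p a s = l ^+ 2 * sqdist p a b.
Proof. by rewrite /sqdist => -> ->; ring. Qed.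

Lemma chord_sqdist_r p s a b l :
  (p s).1 = (p a).1 + l * ((p b).1 - (p a).1) ->
  (p s).2 = (p a).2 + l * ((p b).2 - (p a).2) ->
  sqdist p s b = (1 - l) ^+ 2 * sqdist p a b.
Proof. by rewrite /sqdist => -> ->; ring. Qed.

Lemma chord_eq1 l (d : R) : 0 <= l <= 1 -> 0 < d -> d <= l ^+ 2 * d -> l = 1.
Proof.
move=> /andP[l0 l1] d0; rewrite ler_pMl // => h.
by have : l ^+ 2 <= l by [rewrite expr2 ler_piMl]; lra.
Qed.

(** A disc is convex: the squared distance from a point of the chord to [p t] is the weighted mean
    of those of the ends, minus [l (1 - l)] times the squared length of the chord. *)
Lemma chord_in_ball p s a b t l (r : R) : 0 <= l <= 1 ->
  (p s).1 = (p a).1 + l * ((p b).1 - (p a).1) ->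
  (p s).2 = (p a).2 + l * ((p b).2 - (p a).2) ->
  sqdist p a t <= r -> sqdist p b t <= r -> sqdist p s t <= r.
Proof.
move=> /andP[l0 l1]; rewrite /sqdist => -> ->.
set A1 := (p a).1; set A2 := (p a).2; set B1 := (p b).1; set B2 := (p b).2.
set T1 := (p t).1; set T2 := (p t).2 => ha hb.
have -> : (A1 + l * (B1 - A1) - T1) ^+ 2 + (A2 + l * (B2 - A2) - T2) ^+ 2 =
  (1 - l) * ((A1 - T1) ^+ 2 + (A2 - T2) ^+ 2) + l * ((B1 - T1) ^+ 2 + (B2 - T2) ^+ 2)
  - l * (1 - l) * ((A1 - B1) ^+ 2 + (A2 - B2) ^+ 2) by ring.
have h1 : (1 - l) * ((A1 - T1) ^+ 2 + (A2 - T2) ^+ 2) <= (1 - l) * r.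
  by apply: ler_wpM2l => //; lra.
have h2 : l * ((B1 - T1) ^+ 2 + (B2 - T2) ^+ 2) <= l * r by apply: ler_wpM2l.
have h3 : 0 <= l * (1 - l) * ((A1 - B1) ^+ 2 + (A2 - B2) ^+ 2).
  by apply: mulr_ge0; [apply: mulr_ge0; lra|rewrite addr_ge0 ?sqr_ge0].
by lra.
Qed.

Lemma closed_le_cont (T : topologicalType) (f : T -> R) (y : R) :
  continuous f -> closed [set x | f x <= y].
Proof. by move=> cf; apply: (@closed_comp _ _ f [set x | x <= y]) => [x _|];
  [exact: cf|exact: closed_le]. Qed.

Lemma continuous_sqdist p : continuous p ->
  continuous (fun z : R * R => sqdist p z.1 z.2).
Proof.
move=> cp; apply: (continuous_plane_sqdist (f := fun z => p z.1) (g := fun z => p z.2)).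
  by apply: continuous_compT cp => z; exact: cvg_fst.
by apply: continuous_compT cp => z; exact: cvg_snd.
Qed.

Lemma continuous_sqdist_to p t : continuous p -> continuous (fun s => sqdist p s t).
Proof.
move=> cp.
apply: (@continuous_compT _ _ _ (fun s => (s, t)) (fun z => sqdist p z.1 z.2)).
  by apply: continuous_pair => x; [exact: cvg_id|exact: cst_continuous].
exact: continuous_sqdist.
Qed.

Lemma curve_separation p (tau A : R) : continuous p -> injective p -> 0 < tau ->
  exists2 c : R, 0 < c & forall s t, 0 <= s <= A -> 0 <= t <= A ->
    tau <= `|s - t| -> c <= sqdist p s t.
Proof.
move=> cp inj_p tau0.
pose g (z : R * R) := sqdist p z.1 z.2 + Num.max 0 (tau - `|z.1 - z.2|).
have cg : continuous g.
  have c1 : continuous (fun z : R * R => tau - `|z.1 - z.2|).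
    move=> z; apply: cvgB; first exact: cst_continuous.
    by apply: cvg_norm; apply: cvgB; [exact: cvg_fst|exact: cvg_snd].
  by move=> z; apply: cvgD; [exact: continuous_sqdist|exact: (continuous_max0 c1)].
have cK : compact (`[0, A] `*` `[0, A] : set (R * R)).
  by apply: compact_setX; exact: segment_compact.
have [|c c0 H] := compact_pos_lb cK (continuous_subspaceT cg).
  move=> [s t] _; rewrite /g /=; have [->|st] := eqVneq s t.
    by apply: ltr_wpDl (sqdist_ge0 _ _ _) _;
      rewrite subrr normr0 subr0 lt_max tau0 orbT.
  by apply: ltr_wpDr (sqdist_gt0 inj_p st); rewrite le_max lexx.
exists c => // s t hs ht st.
have /H : (`[0, A] `*` `[0, A] : set (R * R)) (s, t) by split; rewrite /= in_itv.
by rewrite /g /= max_l ?addr0 // subr_le0.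
Qed.

(** The extremal choices of [S] and of the pair [a], [b] free both segments: a point of the curve
    inside one of them, at an admissible time, would be a closer return or form a closer pair. The
    base point [p 1] has pieces of the curve on both sides. *)
Theorem injective_curve_not_recurrent p : continuous p -> injective p ->
  (forall e : R, 0 < e -> exists2 r : R, 0 < r &
    forall s u, `|u| <= 1 / 2 -> sqdist p s 1 <= r -> sqdist p (s + u) (1 + u) <= e) ->
  (forall t0 e A : R, 0 < e -> exists2 t, A <= t & sqdist p t t0 < e) -> False.
Proof.
move=> cp inj_p Hstrand Hrec.
have [tau hT] : exists tau : R, 8 * tau = 1 by exists 8^-1; lra.
have tau0 : 0 < tau by lra.
have [c c0 Hc] := curve_separation 2 cp inj_p tau0.
have [e e0 ec] : exists2 e : R, 0 < e & 2000 * e = c by exists (c / 2000); lra.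
have [r0 r00 Hr0] := Hstrand e e0.
have [r r0' [rr0 re]] : exists2 r : R, 0 < r & r <= r0 /\ r <= e.
  by exists (Num.min r0 e); rewrite ?lt_min ?r00 // !ge_min !lexx orbT.
have [l0 l02 Hl0] := Hrec 1 r 2 r0'.
have strand s u : sqdist p s 1 <= r -> `|u| <= 1 / 2 -> sqdist p (s + u) (1 + u) <= e.
  by move=> hs hu; apply: Hr0 => //; exact: le_trans rr0.
(* [S] is the time of the closest return to [p 0] up to time [t1]. *)
have cd0 := @continuous_sqdist_to p 0 cp.
have [|mu mu0 Hmu] := compact_pos_lb (@segment_compact R tau (l0 +
  1)) (continuous_subspaceT cd0).
  by move=> s /=; rewrite in_itv /= => hs; apply: sqdist_gt0 => //; rewrite gt_eqF //;
    lra_with hs tau0.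
have [t1 t1l Ht1] : exists2 t, l0 + 1 <= t & sqdist p t 0 < Num.min mu e.
  by apply: Hrec; rewrite lt_min mu0.
move: Ht1; rewrite lt_min => /andP[t1mu t1e].
have [|S hS HS] := @EVT_min R (fun s => sqdist p s 0) tau t1 _ (continuous_subspaceT
  cd0).
  by lra.
move: hS; rewrite in_itv /= => /andP[S1 S2].
have St1 : sqdist p S 0 <= sqdist p t1 0.
  by apply: HS; rewrite in_itv /=; lra_with hT l02 t1l.
have Smin t : tau <= t <= S -> sqdist p S 0 <= sqdist p t 0.
  by move=> ht; apply: HS; rewrite in_itv /=; lra_with S2 ht.
(* By the choice of [mu], times from [tau] to [l0 + 1] are farther from [p 0] than [t1] is. Hence
   [l0] precedes [S], and the pair [(1, l0)] shows below that [K] is nonempty. *)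
have Sl0 : l0 + 1 < S.
  rewrite ltNge; apply/negP => h.
  have : mu <= sqdist p S 0 by apply: Hmu; rewrite /= in_itv /=; lra_with S1 h.
  by lra_with St1 t1mu.
have S0e : sqdist p 0 S <= e by rewrite sqdistC; lra_with St1 t1e.
(* [p a], [p b] is a closest pair of points on distinct strands near [p 1]. *)
pose K := (`[0, S] `*` `[0, S] : set (R * R)) `&` ([set z | z.1 - z.2 <= - tau] `&`
  ([set z | sqdist p z.1 1 <= r] `&` [set z | sqdist p z.2 1 <= r])).
have cK : compact K.
  have cf : continuous (@fst R R) by move=> z; exact: cvg_fst.
  have cs : continuous (@snd R R) by move=> z; exact: cvg_snd.
  have cd1 := @continuous_sqdist_to p 1 cp.
  apply: compact_closedI.
    by apply: compact_setX; exact: segment_compact.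
  apply: closedI; first by apply: closed_le_cont => z; apply: cvgB;
    [exact: cf|exact: cs].
  by apply: closedI; apply: closed_le_cont;
    [exact: (continuous_compT cf cd1)|exact: (continuous_compT cs cd1)].
have KP s t : 0 <= s <= S -> 0 <= t <= S -> s + tau <= t -> sqdist p s 1 <= r ->
    sqdist p t 1 <= r -> K (s, t).
  move=> hs ht st hsr htr; split; first by split; rewrite /= in_itv.
  by split; [change (s - t <= - tau); lra_with st|split].
have s11 : sqdist p 1 1 <= r by rewrite /sqdist !subrr expr0n /= addr0 ltW.
have K0 : K !=set0 by exists (1, l0); apply: KP => //;
  [lra_with l02 Sl0|lra_with l02 Sl0|lra_with hT l02|exact: ltW].
have [[a b] /set_mem] :=
  compact_EVT_min K0 cK (continuous_subspaceT (continuous_sqdist cp)).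
move=> [[/= a0 b0] [/= ab [ar br]]] Hab.
move: a0 b0; rewrite !in_itv /= => a0 b0.
have {}Hab s t : 0 <= s <= S -> 0 <= t <= S -> tau <= `|s - t| -> sqdist p s 1 <= r ->
    sqdist p t 1 <= r -> sqdist p a b <= sqdist p s t.
  move=> hs ht; have [st|ts] := leP s t => hst hsr htr.
    by apply: (Hab (s, t)); apply/mem_set/KP => //; move: hst; rewrite ler0_norm;
      lra_with st.
  rewrite (sqdistC p s); apply: (Hab (t, s)); apply/mem_set/KP => //.
  by move: hst; rewrite ger0_norm; lra_with ts.
have d_ab : 0 < sqdist p a b by apply: sqdist_gt0 => //; rewrite lt_eqF //;
  lra_with ab tau0.
(* The next three bounds keep 0, [a], [b] and [S] apart: otherwise, following a strand along the
   piece around time 1 would give two points of the initial piece too close for [c]. *)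
have abS : b + tau <= S.
  rewrite leNgt; apply/negP => h.
  have hu : `|S - b| <= 1 / 2 by rewrite ger0_norm; lra_with h b0 hT.
  have := strand b _ br hu; have -> : b + (S - b) = S by ring.
  have : c <= sqdist p 0 (1 + (S - b)).
    by apply: Hc; [lra|lra_with h b0 hT|rewrite ler0_norm; lra_with h b0 hT].
  by have := sqdist_tri p 0 S (1 + (S - b)); lra_with S0e ec e0.
have a12 : 1 / 2 <= a.
  rewrite leNgt; apply/negP => h.
  have : c <= sqdist p a 1 by apply: Hc; [lra_with h a0|lra|rewrite ler0_norm;
    lra_with h hT].
  by lra_with ar re ec e0.
have ab3 : a + 3 * tau <= b.
  rewrite leNgt; apply/negP => h.
  have hu : `|b - a| <= 1 / 2 by rewrite ger0_norm; lra_with h ab hT.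
  have := strand a _ ar hu; have -> : a + (b - a) = b by ring.
  have : c <= sqdist p 1 (1 + (b - a)).
    by apply: Hc; [lra|lra_with h ab hT|rewrite ler0_norm; lra_with h ab hT].
  by have := sqdist_tri p 1 b (1 + (b - a)); rewrite (sqdistC p 1 b);
    lra_with br re ec e0.
have pE x y : (p x).1 = (p y).1 -> (p x).2 = (p y).2 -> x = y.
  by move=> h1 h2; apply: inj_p;
    rewrite (surjective_pairing (p x)) h1 h2 -surjective_pairing.
apply: (@no_parallel_gap R p tau e c a b S) => //; split => //;
  [lra_with e0|lra_with ec| | | |].
- by move=> u; exact: strand.
- by move=> u; exact: strand.
- move=> s hs sa sb [l hl [e1 e2]].
  have sr := chord_in_ball hl e1 e2 ar br.
  have [h|h] := leP tau `|a - s|.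
    have := Hab a s a0 hs h ar sr;
      rewrite (chord_sqdist_l e1 e2) => /(chord_eq1 hl d_ab) l1.
    by move/eqP: sb; apply; apply: pE; rewrite ?e1 ?e2 l1; ring.
  have h' : tau <= `|s - b|.
    by move: h; rewrite ltr_norml => h; rewrite ler0_norm; lra_with hT h ab3.
  have := Hab s b hs b0 h' sr br; rewrite (chord_sqdist_r e1 e2).
  have hl' : 0 <= 1 - l <= 1 by lra_with hl.
  move=> /(chord_eq1 hl' d_ab) l1; have {}l1 : l = 0 by lra_with l1.
  by move/eqP: sa; apply; apply: pE; rewrite ?e1 ?e2 l1; ring.
- move=> s hs [l hl [e1 e2]].
  have := Smin s ltac:(lra_with hs a12 abS hT);
    rewrite (sqdistC p S) (sqdistC p s) (chord_sqdist_l e1 e2).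
  have d0S : 0 < sqdist p 0 S by apply: sqdist_gt0 => //; rewrite lt_eqF //;
    lra_with Sl0 l02.
  move=> /(chord_eq1 hl d0S) l1.
  have : s = S by apply: pE; rewrite ?e1 ?e2 l1; ring.
  by lra_with hs abS tau0.
Qed.

End RecurrentCurve.

(** * Coding orbits *)

Section Coding.
Variables (R : realType) (X : normedModType R) (K : set X) (f : X -> X).
Variables (L : finType) (lbl : X -> L) (J : nat) (e d : R).
Implicit Types (x y : X) (w : seq (option (bool * L))).

Definition almost_period_upto (p : nat) x : Prop := forall i, (i <= J * p)%N ->
  `|iter (i + p) f x - iter i f x| <= d.

(** A word has one letter per time step. The Boolean tells letters of single steps from letters of
    jumps, and the blanks [None], free in [cost], stand for the steps predicted by almost
    periodicity. *)
Definition jump_block p x : seq (option (bool * L)) :=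
  [seq Some (false, lbl (iter i f x)) | i <- iota 0 p] ++ nseq (J * p) None.

(* A jump spends p letters to describe (J + 1) * p steps of the orbit. *)
Inductive coded : X -> seq (option (bool * L)) -> Prop :=
| coded_nil x : coded x [::]
| coded_step x w : coded (f x) w -> coded x (Some (true, lbl x) :: w)
| coded_jump x p w : (0 < p)%N -> almost_period_upto p x ->
    coded (iter (J.+1 * p) f x) w -> coded x (jump_block p x ++ w).

Lemma coded_inv x w : coded x w ->
  [\/ w = [::], exists2 w', w = Some (true, lbl x) :: w' & coded (f x) w' |
    exists p w', [/\ (0 < p)%N, almost_period_upto p x, w = jump_block p x ++ w' &
      coded (iter (J.+1 * p) f x) w']].
Proof.
by case=> {x w} [x|x w h|x p w p0 hp h];
  [constructor 1|constructor 2; exists w|constructor 3; exists p, w].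
Qed.

Lemma size_jump_block p x : size (jump_block p x) = (J.+1 * p)%N.
Proof. by rewrite size_cat size_map size_iota size_nseq mulSn. Qed.

(** The first blank reveals the length of the jump, so the word can be decoded. *)
Lemma find_jump_block p x w : (0 < J)%N -> (0 < p)%N ->
  find (pred1 None) (jump_block p x ++ w) = p.
Proof.
move=> J0 p0; rewrite /jump_block -catA find_cat has_map /=.
have -> : has (preim (fun i => Some (false,
  lbl (iter i f x))) (pred1 None)) (iota 0 p) = false.
  by apply/hasP => -[].
rewrite size_map size_iota -[RHS]addn0; congr addn.
by have : (0 < J * p)%N by [rewrite muln_gt0 J0]; case: (J * p)%N.
Qed.

Lemma jump_block_inj p x y : jump_block p x = jump_block p y ->
  forall i, (i < p)%N -> lbl (iter i f x) = lbl (iter i f y).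
Proof.
move=> /eqP; rewrite eqseq_cat ?size_map // => /andP[/eqP h _] i ip.
move: h => /(congr1 (fun s => nth None s i)).
by rewrite !(nth_map 0%N) ?size_iota // !nth_iota // => -[].
Qed.

Lemma almost_period_reduce p x q r : (0 < p)%N -> almost_period_upto p x ->
  (q <= J)%N -> (r < p)%N ->
  `|iter (q * p + r) f x - iter r f x| <= d *+ q.
Proof.
move=> p0 h; elim: q => [|q IH] qJ rp; first by rewrite add0n subrr normr0.
rewrite -(subrKA (iter (q * p + r) f x)) mulrS.
apply: le_trans (ler_normD _ _) _; apply: lerD; last exact: IH (ltnW qJ) rp.
have -> : (q.+1 * p + r = (q * p + r) + p)%N by lia.
apply: h; apply: (@leq_trans (q.+1 * p)%N); first by lia.
by rewrite leq_mul2r qJ orbT.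
Qed.

Hypothesis J_gt0 : (0 < J)%N.
Hypothesis d_ge0 : 0 <= d.
Hypothesis fK : forall x, K x -> K (f x).
Hypothesis lblP : forall x y, K x -> K y -> lbl x = lbl y -> `|x - y| <= e.

Lemma iterK n x : K x -> K (iter n f x).
Proof. by move=> Kx; elim: n => //= n IH; exact: fK. Qed.

(** Equal words are parsed equally. Inside a jump, time [i] is reduced to [i %% p] at the cost of at
    most [d *+ J] for each orbit, and there the labels agree. *)
Lemma coded_inj x y w : K x -> K y -> coded x w -> coded y w ->
  forall i, (i < size w)%N -> `|iter i f x - iter i f y| <= e + d *+ (2 * J).
Proof.
move=> Kx Ky cx; elim: cx y Kx Ky => {x w} [//|x w cx IH|x p w p0 hx cx IH] y Kx Ky cy.
- case: (coded_inv cy) => [//|[w' [El Ew] cy']|[p [w' [p0 _ Ew _]]]]; last first.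
    by case: p p0 Ew.
  subst w' => -[_|i] /=.
    by apply: le_trans (lblP Kx Ky El) _; rewrite lerDl mulrn_wge0.
  rewrite ltnS -!iterS !iterSr; exact: IH (fK Kx) (fK Ky) cy' i.
- case: (coded_inv cy) => [Ew|[w' Ew _]|[q [w' [q0 hy Eu cy']]]].
  + by case: p p0 Ew {IH hx cx cy}.
  + by case: p p0 Ew {IH hx cx cy}.
  have qp : p = q by rewrite -(find_jump_block x w J_gt0 p0) Eu find_jump_block.
  subst q; move/eqP: Eu;
    rewrite eqseq_cat ?size_jump_block // => /andP[/eqP Eb /eqP Ew].
  subst w' => i; rewrite size_cat size_jump_block.
  have [ip _|ip iw] := ltnP i (J.+1 * p).
    have qJ : (i %/ p <= J)%N by rewrite -ltnS ltn_divLR.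
    have rp : (i %% p < p)%N by rewrite ltn_mod.
    have h1 := almost_period_reduce p0 hx qJ rp; have h2 :=
      almost_period_reduce p0 hy qJ rp.
    have h3 := lblP (iterK (i %% p) Kx) (iterK (i %% p) Ky) (jump_block_inj Eb rp).
    rewrite -divn_eq in h1 h2.
    have le_dJ : d *+ (i %/ p) <= d *+ J by apply: ler_wpMn2l.
    have -> : e + d *+ (2 * J) = d *+ J + (e + d *+ J).
      by rewrite mulnC mulrnA mulr2n addrCA.
    rewrite -(subrKA (iter (i %% p) f x)).
    apply: le_trans (ler_normD _ _) _; apply: lerD; first exact: (le_trans h1 le_dJ).
    rewrite -(subrKA (iter (i %% p) f y)).
    apply: le_trans (ler_normD _ _) _; apply: lerD => //.
    by rewrite distrC; exact: (le_trans h2 le_dJ).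
  have := IH _ (iterK _ Kx) (iterK _ Ky) cy' (i - J.+1 * p)%N.
  by rewrite -!iterD subnK //; apply; rewrite ltn_subLR.
Qed.

Definition cost w := count isSome w.

Lemma cost_jump_block p x : cost (jump_block p x) = p.
Proof.
rewrite /cost count_cat count_map count_nseq mul0n addn0 -[RHS](size_iota 0 p).
exact: count_predT.
Qed.

Lemma coded_steps n x : exists w, [/\ size w = n, coded x w & cost w = n].
Proof.
elim: n x => [|n IH] x; first by exists [::]; split => //; exact: coded_nil.
have [w [sw cw w0]] := IH (f x).
exists (Some (true, lbl x) :: w); split; rewrite /= ?sw //; first exact: coded_step.
by rewrite /cost /= -/(cost w) w0.
Qed.

Lemma count_iota_iter (B : pred X) q n x :
  count (fun i => B (iter i f x)) (iota q n) = count (fun i => B (iter i f (iter q f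
    x))) (iota 0 n).
Proof.
rewrite -[X in iota X _](addn0 q) iotaDl count_map; apply: eq_count => i /=.
by rewrite addnC iterD.
Qed.

(** Greedy coding: outside [B] a jump is made, whose cost is [1 / (J + 1)] of its length. A point of
    [B] costs one letter, and so does each step of a tail shorter than [J.+1 * M], whence the last
    term. *)
Lemma coded_exists (M : nat) (B : pred X) :
  (forall x, K x -> ~~ B x -> exists p, [/\ (0 < p)%N,
    (p <= M)%N & almost_period_upto p x]) ->
  forall n x, K x -> exists w, [/\ size w = n, coded x w &
    (J.+1 * cost w <= n + J.+1 * (count (fun i => B (iter i f x)) (iota 0 n) +
      J.+1 * M))%N].
Proof.
move=> HB n; elim/ltn_ind: n => n IH x Kx.
have [nM|nM] := ltnP n (J.+1 * M).
  have [w [sw cw w0]] := coded_steps n x; exists w; split => //; rewrite w0.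
  by apply: leq_trans (leq_addl _ _);
    rewrite leq_mul2l /= (leq_trans (ltnW nM)) // leq_addl.
case: (boolP (B x)) => Bx; last first.
  have [p [p0 pM hp]] := HB x Kx Bx.
  have qn : (J.+1 * p <= n)%N by apply: leq_trans nM; rewrite leq_mul2l.
  have q0 : (0 < J.+1 * p)%N by rewrite muln_gt0.
  have [|w [sw cw hw]] := IH (n - J.+1 * p)%N _ (iter (J.+1 * p) f x) (iterK _ Kx).
    by rewrite ltn_subrL q0 (leq_trans q0).
  exists (jump_block p x ++ w); split.
  - by rewrite size_cat size_jump_block sw subnKC.
  - exact: coded_jump.
  rewrite /cost count_cat -!/(cost _) cost_jump_block.
  rewrite -[in iota 0 n](subnKC qn) iotaD count_cat add0n (count_iota_iter B (J.+1 *
    p)).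
  rewrite mulnDr; apply: leq_trans (leq_add (leqnn _) hw) _.
  rewrite addnA subnKC // leq_add2l leq_mul2l /=.
  by rewrite leq_add2r leq_addl.
case: n IH nM => [|n] IH nM.
  by exists [::]; split; [|exact: coded_nil|rewrite muln0].
have [w [sw cw hw]] := IH n (ltnSn n) (f x) (fK Kx).
exists (Some (true, lbl x) :: w); split; rewrite /= ?sw //; first exact: coded_step.
rewrite /cost /= -/(cost w) Bx (count_iota_iter B 1) /=.
move: hw; set C := count _ _; lia.
Qed.

End Coding.

(** * Rare visits to non-recurrent points *)

Section Visits.
Variables (R : realType) (X : normedModType R) (K : set X).
Hypothesis cK : compact K.

(** The label is the index of the first ball containing the point, in a finite cover by balls of
    radius [r / 2]. *)
Lemma compact_label (r : R) : 0 < r -> exists (N : nat) (lbl : X -> 'I_N.+1),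
  forall x y, K x -> K y -> lbl x = lbl y -> `|x - y| < r.
Proof.
move=> r0; have r2 : 0 < r / 2 by rewrite divr_gt0.
have cov := cK; rewrite compact_cover in cov.
have [|D _ KD] := cov X [set: X] (fun c => ball c (r / 2)) (fun c _ => ball_open c (r /
  2)).
  by move=> x _; exists x => //; exact: ballxx.
pose s : seq X := finmap.enum_fset D.
pose near_c (x c : X) := `|x - c| < r / 2.
have KDs x : K x -> has (near_c x) s.
  move=> /KD[c /= cD]; rewrite -ball_normE /= distrC => xc.
  by apply/hasP; exists c.
exists (size s), (fun x => inord (find (near_c x) s)) => x y Kx Ky.
move=> /(congr1 val); rewrite /= !inordK ?ltnS ?find_size // => E.
have := nth_find x (KDs x Kx); have := nth_find x (KDs y Ky); rewrite -E /near_c.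
set c := nth _ _ _ => yc xc.
rewrite -(subrKA c); apply: le_lt_trans (ler_normD _ _) _.
by rewrite (distrC c) (splitr r) ltrD.
Qed.

Variable f : X -> X.
Hypothesis fK : forall x, K x -> K (f x).

Definition far_return (m : nat) (r : R) (x : X) : bool :=
  `[< forall j, (0 < j <= m)%N -> r <= `|iter j f x - x| >].

(* Two visits at distance at most m are r-separated, hence carry different labels. *)
Lemma visits_bound (r : R) : 0 < r -> exists L : nat, forall m n x, K x ->
  (count (fun i => far_return m r (iter i f x)) (iota 0 n) * m <= L * (n + m))%N.
Proof.
move=> r0; have [N [lbl lblP]] := compact_label r0.
exists N.+1 => m; elim/ltn_ind => n IH x Kx.
set B := (X in count X _).
have itK i : K (iter i f x) by exact: iterK.
have base k : (k <= m)%N -> (count B (iota 0 k) <= N.+1)%N.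
  move=> km; rewrite -size_filter -(size_map (fun i => lbl (iter i f x))).
  have u : uniq [seq lbl (iter i f x) | i <- iota 0 k & B i].
    rewrite map_inj_in_uniq ?filter_uniq ?iota_uniq // => i j.
    rewrite !mem_filter !mem_iota !add0n /= => /andP[/asboolP Bi ik] /andP[/asboolP Bj
      jk] E.
    have lt := lblP _ _ (itK i) (itK j) E.
    case: (ltngtP i j) => // ij.
      have := Bi (j - i)%N; rewrite -iterD subnK ?(ltnW ij) // distrC leNgt lt.
      by move=> /(_ ltac:(lia)).
    have := Bj (i - j)%N; rewrite -iterD subnK ?(ltnW ij) // leNgt lt.
    by move=> /(_ ltac:(lia)).
  by rewrite -(card_uniqP u) (leq_trans (max_card _)) // card_ord.
have [nm|mn] := leqP n m.
  by apply: leq_mul; [exact: base|exact: leq_addl].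
case: m @B IH base mn => [|m] B IH base mn; first by rewrite muln0.
rewrite -[in iota 0 n](subnKC (ltnW mn)) iotaD count_cat add0n mulnDl.
have h := IH (n - m.+1)%N ltac:(lia) (iter m.+1 f x) (itK m.+1).
rewrite /B (count_iota_iter f (far_return m.+1 r) m.+1) -/B.
have b := base m.+1 (leqnn _).
apply: (@leq_trans (N.+1 * m.+1 + N.+1 * (n - m.+1 + m.+1))).
  by apply: leq_add; [rewrite leq_mul2r b orbT|exact: h].
by rewrite -mulnDr leq_mul2l /=; lia.
Qed.

End Visits.

(** * Almost periods versus far returns *)

Section RecurrencePeriodic.
Variables (R : realType) (X : completeNormedModType R) (K : set X) (f : X -> X).
Hypotheses (cK : compact K) (fK : forall x, K x -> K (f x)).
Hypothesis cf : {within K, continuous f}.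
Hypothesis rec_ap : forall x, K x ->
  (forall e : R, 0 < e -> exists2 n : nat, (0 < n)%N & `|iter n f x - x| < e) ->
  forall d : R, 0 < d -> exists2 p : nat, (0 < p)%N &
    forall i, `|iter (i + p) f x - iter i f x| <= d.

Lemma iter_near n x (e : R) : K x -> 0 < e ->
  \forall y \near x, K y -> `|iter n f y - iter n f x| < e.
Proof.
elim: n x e => [|n IH] x e Kx e0 /=.
  near=> y => _; rewrite distrC; near: y.
  exact: (@cvgr_dist_lt _ _ _ _ _ id x cvg_id).
have /subspace_continuousP/(_ _ (iterK fK n Kx)) := cf.
move=> /cvgr_dist_lt/(_ _ e0); rewrite near_withinE => h.
have [dl dl0 Hd] : exists2 dl : R, 0 < dl & forall z, `|z - iter n f x| < dl -> K z ->
    `|f z - f (iter n f x)| < e.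
  move/nbhs_ballP: h => [dl dl0 H]; exists dl => // z zd Kz; rewrite distrC.
  by apply: H => //; rewrite -ball_normE /= distrC.
have := IH x dl Kx dl0; apply: filterS => y Hy Ky.
by apply: Hd; [exact: Hy|exact: iterK].
Unshelve. all: by end_near. Qed.

(* By visits_bound the second alternative is rare along an orbit when m k is large. *)
Lemma rare_or_periodic (J : nat) (d : R) (m : nat -> nat) : 0 < d ->
  exists M : nat, forall x, K x ->
    (exists p, [/\ (0 < p)%N, (p <= M)%N & almost_period_upto f J d p x]) \/
    (exists2 k, (k < M)%N & forall j, (0 < j <= m k)%N ->
       k.+1%:R^-1 / 2 <= `|iter j f x - x|).
Proof.
move=> d0.
pose P (M : nat) x := K x ->
    (exists p, [/\ (0 < p)%N, (p <= M)%N & almost_period_upto f J d p x]) \/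
    (exists2 k, (k < M)%N & forall j, (0 < j <= m k)%N ->
       k.+1%:R^-1 / 2 <= `|iter j f x - x|).
(* Each point has a neighbourhood on which the dichotomy holds for all large [M]; compactness, as
   near covering, yields a single [M]. *)
have ncov := (compact_near_coveringP K).1 cK nat \oo P _.
suff: \forall M \near \oo, K `<=` P M.
  by move=> [M _ HM]; exists M => x Kx; exact: (HM M (leqnn _) x Kx Kx).
apply: ncov => x Kx.
have near_all n (e : R) : 0 < e -> \forall y \near x, K y ->
    forall i, (i <= n)%N -> `|iter i f y - iter i f x| < e.
  move=> e0; elim: n => [|n IH].
    have := @iter_near 0%N x e Kx e0; apply: filterS => y Hy Ky i.
    by rewrite leqn0 => /eqP ->; exact: Hy.
  have := @iter_near n.+1 x e Kx e0; apply: filterS2 IH => y IH Hy Ky i.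
  by rewrite leq_eqVlt => /orP[/eqP ->|]; [exact: Hy|rewrite ltnS; exact: IH].
have ge_oo n : \forall M \near \oo, (n <= M)%N by exists n.
have [Hrec|] := pselect (forall e : R, 0 < e -> exists2 n : nat,
  (0 < n)%N & `|iter n f x - x| < e).
  have [p p0 Hp] := rec_ap Kx Hrec (divr_gt0 d0 (@ltr0Sn R 1)).
  exists ([set y | K y -> forall i, (i <= J * p + p)%N -> `|iter i f y - iter i f x|
    < d / 4],
    [set M | (p <= M)%N]).
    by split => /=; [apply: near_all; lra|exact: ge_oo].
  move=> [y M] [/= Hy pM] Ky; left; exists p; split => // i iJ.
  have h1 := Hy Ky i (leq_trans iJ (leq_addr _ _)).
  have := Hy Ky (i + p)%N; rewrite leq_add2r iJ => /(_ isT) h2.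
  have h3 := Hp i.
  have h4 := ler_distD (iter (i + p) f x) (iter (i + p) f y) (iter i f y).
  have := ler_distD (iter i f x) (iter (i + p) f x) (iter i f y).
  by rewrite (distrC (iter i f x)); lra.
move=> /existsNP[e /not_implyP[e0 He]].
have far n : (0 < n)%N -> e <= `|iter n f x - x|.
  by move=> n0; rewrite leNgt; apply/negP => h; apply: He; exists n.
(* The orbit of [x] stays at distance at least [e >= q] from [x]; moving both ends by less than
   [q / 4] leaves [q / 2]. *)
pose k := Num.trunc e^-1; pose q : R := k.+1%:R^-1.
have q0 : 0 < q by rewrite invr_gt0 ltr0n.
have qe : q <= e.
  by rewrite /q -(invrK e) lef_pV2 ?posrE ?invr_gt0 ?ltr0n // ltW // truncnS_gt.
exists ([set y | K y -> forall i, (i <= m k)%N -> `|iter i f y - iter i f x| < q / 4],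
    [set M | (k < M)%N]).
  by split => /=; [apply: near_all; lra|exact: ge_oo].
move=> [y M] [/= Hy kM] Ky; right; exists k => // j /andP[j0 jm]; rewrite -/q.
have h1 := Hy Ky j jm; have h2 := Hy Ky 0%N (leq0n _).
have h3 := far j j0.
have h4 := ler_distD (iter j f y) (iter j f x) x.
have := ler_distD y (iter j f y) x.
move: h2 h4; rewrite (distrC (iter j f x) (iter j f y)) /= => h2 h4.
by lra.
Qed.

End RecurrencePeriodic.

(** * Vanishing of the entropy *)

Section CountWords.
Variables (R : realType) (T : finType).

Lemma sum_words_cost (t : R) (n : nat) :
  \sum_(w : {ffun 'I_n -> option T}) \prod_(i < n) (if w i is Some _ then t else 1) =
  (1 + #|T|%:R * t) ^+ n.
Proof.
rewrite -(bigA_distr_bigA (fun _ (o : option T) => if o is Some _ then t else 1)).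
rewrite prodr_const card_ord; congr (_ ^+ _).
rewrite (bigD1 None) //= (eq_bigr (fun=> t)); last by case.
by rewrite sumr_const (@cardC1 _ None) card_option mulr_natl.
Qed.

(** A Chernoff-type bound: a word with at most [m] letters has weight at least [t ^+ m], and
    [sum_words_cost] gives the total weight of all words. *)
Lemma count_words (I : eqType) (E : seq I) (F : I ->
  seq (option T)) (n m : nat) (t : R) :
  0 < t <= 1 -> uniq E -> {in E &, injective F} ->
  {in E, forall x, size (F x) = n} -> {in E, forall x, (count isSome (F x) <= m)%N} ->
  (size E)%:R * t ^+ m <= (1 + #|T|%:R * t) ^+ n.
Proof.
move=> /andP[t0 t1] uE injF sF cF.
pose G x : {ffun 'I_n -> option T} := [ffun i : 'I_n => nth None (F x) i].
have injG : {in E &, injective G}.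
  move=> x y xE yE /ffunP h; apply: injF => //; apply: (@eq_from_nth _ None).
    by rewrite !sF.
  by move=> i; rewrite sF // => ni; have := h (Ordinal ni); rewrite !ffunE.
pose g (w : {ffun 'I_n -> option T}) : R :=
  \prod_(i < n) (if w i is Some _ then t else 1).
have g_ge0 w : 0 <= g w.
  by apply: prodr_ge0 => i _; case: (w i) => // _; exact: ltW.
have gG x : x \in E -> t ^+ m <= g (G x).
  move=> xE; have -> : g (G x) = t ^+ count isSome (F x).
    rewrite /g (eq_bigr (fun i : 'I_n => if nth None (F x) i is Some _ then t else 1));
      last by move=> i _; rewrite ffunE.
    rewrite -(big_mkord xpredT (fun i => if nth None (F x) i is Some _ then t else 1)).
    rewrite -(sF x xE) -(big_nth None xpredT (fun o : option T => if o is Some _ then t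
      else 1)).
    elim: (F x) => [|[u|] w IH]; rewrite ?big_nil // big_cons IH /= ?mul1r //.
    by rewrite exprS.
  by apply: ler_wiXn2l; rewrite ?(ltW t0) ?cF.
rewrite -sum_words_cost -/g.
have -> : (size E)%:R * t ^+ m = \sum_(x <- E) t ^+ m.
  by rewrite big_const_seq count_predT iter_addr addr0 mulr_natl.
rewrite big_seq; apply: (@le_trans _ _ (\sum_(x <- E | x \in E) g (G x))).
  by apply: ler_sum => x; exact: gG.
rewrite -big_seq -(big_map G xpredT g) big_uniq ?map_inj_in_uniq //=.
rewrite [leRHS](bigID (mem (map G E))) /= lerDl.
by apply: sumr_ge0 => w _; exact: g_ge0.
Qed.

End CountWords.

Section EntropyZero.
Variables (R : realType) (X : completeNormedModType R) (K : set X) (f : X -> X).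
Hypotheses (cK : compact K) (fK : forall x, K x -> K (f x)).
Hypothesis cf : {within K, continuous f}.
Hypothesis rec_ap : forall x, K x ->
  (forall e : R, 0 < e -> exists2 n : nat, (0 < n)%N & `|iter n f x - x| < e) ->
  forall d : R, 0 < d -> exists2 p : nat, (0 < p)%N &
    forall i, `|iter (i + p) f x - iter i f x| <= d.

Lemma short_codes (L : finType) (lbl : X -> L) (J : nat) (d : R) : (0 < J)%N -> 0 < d ->
  exists C : nat, forall n x, K x -> exists w, [/\ size w = n, coded f lbl J d x w &
    (J.+1 * cost w <= 2 * n + C)%N].
Proof.
move=> J0 d0; pose r k : R := k.+1%:R^-1 / 2.
have r0 k : 0 < r k by rewrite divr_gt0 // invr_gt0 ltr0n.
have [V HV] := choice (fun k => visits_bound cK fK (r0 k)).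
(* This makes the frequency of visits of level [k] at most [1 / ((J + 1) 2^(k + 1))] up to a bounded
   error. The sum over all levels stays below [1 / (J + 1)], however many levels [M] the next line
   produces from [m]. *)
pose m k := ((V k).+1 * (J.+1 * 2 ^ k.+1))%N.
have [M HM] := rare_or_periodic cK fK cf rec_ap J m d0.
pose bad k0 x := has (fun k => far_return f (m k) (r k) x) (iota 0 k0).
(* The quotient of [(2 ^ k0).-1] by [2 ^ k0] is the partial sum of the geometric series, here
   cleared of denominators. *)
have bad_count k0 : exists C : nat, forall n x, K x ->
    (J.+1 * 2 ^ k0 * count (fun i => bad k0 (iter i f x)) (iota 0 n) <= (2 ^ k0).-1 * n
      + C)%N.
  elim: k0 => [|k [C HC]].
    exists 0%N => n x Kx; rewrite (@eq_count _ _ pred0) ?count_pred0 ?muln0 //.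
  exists (2 * C + m k)%N => n x Kx.
  have := HC n x Kx; have := HV k (m k) n x Kx.
  set c := count (fun i => far_return _ _ _ _) _; set b := count _ _ => h1 h2.
  have {}h1 : (J.+1 * 2 ^ k.+1 * c <= n + m k)%N.
    rewrite -(leq_pmul2l (ltn0Sn (V k))); apply: (@leq_trans (V k * (n + m k))%N).
      by apply: leq_trans h1; rewrite /m; apply: eq_leq; ring.
    by rewrite leq_mul2r leqnSn orbT.
  have h3 : (count (fun i => bad k.+1 (iter i f x)) (iota 0 n) <= b + c)%N.
    rewrite -count_predUI; apply: leq_trans (leq_addr _ _).
    apply: sub_count => i; rewrite /bad -addn1 iotaD has_cat /= orbF add0n => /orP[h|h].
      by rewrite /= h.
    by rewrite /= h orbT.
  apply: (@leq_trans (J.+1 * 2 ^ k.+1 * (b + c))%N); first by rewrite leq_mul2l h3 orbT.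
  rewrite mulnDr.
  have h4 : (J.+1 * 2 ^ k.+1 * b <= 2 * ((2 ^ k).-1 * n + C))%N.
    by apply: leq_trans (leq_mul (leqnn 2) h2); rewrite expnS; apply: eq_leq; ring.
  apply: leq_trans (leq_add h4 h1) _; rewrite expnS.
  have : (0 < 2 ^ k)%N by rewrite expn_gt0.
  case: (2 ^ k)%N => // q _.
  have -> : (2 * q.+1).-1 = (2 * q + 1)%N by lia.
  by rewrite succnK; apply: eq_leq; ring.
have [C HC] := bad_count M.
exists (C + J.+1 * (J.+1 * M))%N => n x Kx.
have [|w [sw cw hw]] :=
  @coded_exists R X K f L lbl J d J0 (ltW d0) fK M (bad M) _ n x Kx.
  move=> y Ky /hasPn nb; have [//|[k kM hk]] := HM y Ky.
  by have := nb k; rewrite mem_iota kM => /(_ isT) /asboolPn []; exact: hk.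
exists w; split => //; apply: leq_trans hw _.
have h := HC n x Kx; set b := count _ _ in h *.
have {}h : (J.+1 * b <= n + C)%N.
  have p0 : (0 < 2 ^ M)%N by rewrite expn_gt0.
  rewrite -(leq_pmul2l p0) mulnA (mulnC (2 ^ M)%N); apply: leq_trans h _.
  rewrite mulnDr; apply: leq_add; first by rewrite leq_mul2r leq_pred orbT.
  by rewrite leq_pmull.
by rewrite mulnDr; lia.
Qed.

(** Separated points have distinct codes by [coded_inj], and [count_words] bounds the number of
    codes: [ln (size E)] is at most [n a t - m ln t] with [m] about [2 n / (J + 1)]. *)
Lemma separated_ln_le (eps gam : R) : 0 < eps -> 0 < gam ->
  exists C : R, forall n E, Defs.separated f K n eps E ->
    ln (size E)%:R <= gam * n%:R + C.
Proof.
move=> eps0 gam0.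
have e2 : 0 < eps / 2 by rewrite divr_gt0.
have [N [lbl lblP]] := compact_label cK e2.
pose a : R := #|{: bool * 'I_N.+1}|%:R.
have a0 : 0 < a by rewrite ltr0n card_prod card_bool card_ord.
(* The weight [t] lets [n a t] take half of the rate [gam]; then [J] is so large that [- m ln t]
   takes the other half, up to a constant. *)
pose t := gam / (2 * a + gam).
have t0 : 0 < t by rewrite divr_gt0 //; lra.
have t1 : t <= 1 by rewrite ler_pdivrMr; lra.
have at2 : a * t <= gam / 2.
  by rewrite /t mulrA ler_pdivrMr; [nra|lra].
have lt0 : 0 <= - ln t by rewrite oppr_ge0 ln_le0.
pose J := (Num.trunc (4 * - ln t / gam)).+1.
have HJ : 4 * - ln t <= gam * J.+1%:R.
  rewrite [leRHS]mulrC -ler_pdivrMr //; apply: le_trans (ltW (truncnS_gt _)) _.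
  by rewrite ler_nat.
have J0 : 0 < (J.+1%:R : R) by rewrite ltr0n.
have JJ0 : 0 < (J%:R : R) by rewrite ltr0n.
(* Points with equal codes then stay within [eps / 2 + 2 J d = eps] of each other. *)
pose d := eps / (4 * J%:R).
have d0 : 0 < d by rewrite divr_gt0 // mulr_gt0.
have [C HC] := short_codes lbl (isT : (0 < J)%N) d0.
exists (C%:R * - ln t / J.+1%:R) => n E [uE EK Esep].
have /choice[F HF] : forall x, exists w, K x ->
    [/\ size w = n, coded f lbl J d x w & (J.+1 * cost w <= 2 * n + C)%N].
  move=> x; have [Kx|nKx] := pselect (K x); last by exists [::].
  by have [w Hw] := HC n x Kx; exists w.
pose m := ((2 * n + C) %/ J.+1)%N.
have := @count_words R _ _ E F n m t.
rewrite t0 t1 => /(_ isT uE) H.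
have {}H : (size E)%:R * t ^+ m <= (1 + a * t) ^+ n.
  apply: H.
  - move=> x y xE yE Fxy; apply/eqP/negP => /negP xy.
    have [j jn] := Esep x y xE yE xy.
    have [sx cx _] := HF x (EK x xE); have [sy cy _] := HF y (EK y yE).
    rewrite ltNge => /negP; apply.
    rewrite -Fxy in cy.
    have := @coded_inj R X K f _ lbl J (eps / 2) d isT (ltW d0) fK _ x y (F x) (EK x
      xE) (EK y yE) cx cy j.
    rewrite sx => /(_ _ jn) h; apply: le_trans (h _) _.
      by move=> u v Ku Kv uv; apply/ltW/lblP.
    have -> : d *+ (2 * J) = eps / 2.
      by rewrite -(mulr_natr d) natrM /d; field; rewrite gt_eqF.
    by lra.
  - by move=> x /EK /HF[].
  - by move=> x /EK /HF[_ _ h]; rewrite /m leq_divRL // mulnC.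
have [->|E0] := eqVneq (size E) 0%N.
  rewrite ln0 //; apply: addr_ge0; first by rewrite mulr_ge0 // ltW.
  by rewrite mulr_ge0 ?invr_ge0 ?(ltW J0) // mulr_ge0.
have sE : 0 < ((size E)%:R : R) by rewrite ltr0n lt0n.
have tm : 0 < t ^+ m by rewrite exprn_gt0.
have at1 : 0 < 1 + a * t by rewrite addr_gt0 // mulr_gt0.
have {}H : ln (size E)%:R + m%:R * ln t <= n%:R * (a * t).
  have := H; rewrite -ler_ln ?posrE ?mulr_gt0 ?exprn_gt0 //.
  rewrite lnM ?posrE // !lnXn // -(mulr_natl (ln t)) -(mulr_natl (ln (1 +
    a * t))) => h; apply: le_trans h _.
  rewrite ler_wpM2l // -ler_expR lnK ?posrE //; exact: expR_ge1Dx.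
have mJ : m%:R * J.+1%:R <= 2 * n%:R + C%:R :> R.
  by rewrite -!natrM -natrD ler_nat leq_trunc_div.
have mt : m%:R * - ln t <= n%:R * (gam / 2) + C%:R * - ln t / J.+1%:R.
  have -> : m%:R * - ln t = (m%:R * J.+1%:R) * - ln t / J.+1%:R by field;
    rewrite gt_eqF.
  rewrite ler_pdivrMr //.
  have -> : (n%:R * (gam / 2) + C%:R * - ln t / J.+1%:R) * J.+1%:R =
     n%:R / 2 * (gam * J.+1%:R) + C%:R * - ln t by field; rewrite gt_eqF.
  apply: le_trans (ler_wpM2r lt0 mJ) _; rewrite mulrDl lerD2r.
  apply: (@le_trans _ _ (n%:R / 2 * (4 * - ln t))); first by rewrite le_eqVlt;
    apply/orP; left; apply/eqP; field.
  by rewrite ler_wpM2l // divr_ge0.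
have n0 : 0 <= n%:R :> R by [].
have h := ler_wpM2l n0 at2; move: H mt h; rewrite mulrN.
move: (m%:R * ln t) (n%:R * (a * t)) (C%:R * - ln t / J.+1%:R) => u v w.
by clear; lra.
Qed.

Lemma topological_entropy_eq0 : topological_entropy f K = 0%E.
Proof.
apply/eqP; rewrite eq_le; apply/andP; split.
  apply: ge_ereal_sup => _ [eps /= eps0 <-].
  apply/lee_addgt0Pr => gam gam0; rewrite add0e.
  have g2 : 0 < gam / 2 by rewrite divr_gt0.
  have [C HC] := separated_ln_le eps0 g2.
  rewrite limn_esup_lim; apply: lime_le; first exact: is_cvg_esups.
  (* From this index on, [C] contributes at most [gam / 2] to the rate. *)
  exists (Num.trunc (`|C| / (gam / 2))).+1 => // n0 /= hn0.
  apply: ge_ereal_sup => _ [n /= n0n <-].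
  apply: ge_ereal_sup => _ [E /= HE <-].
  have n_gt : `|C| / (gam / 2) < n%:R.
    by apply: lt_le_trans (truncnS_gt _) _; rewrite ler_nat; exact: leq_trans hn0 n0n.
  have n_pos : 0 < n%:R :> R by apply: le_lt_trans n_gt; rewrite divr_ge0 // ltW.
  rewrite lee_fin ler_pdivrMr //; apply: le_trans (HC n E HE) _.
  move: n_gt; rewrite ltr_pdivrMr // => n_gt.
  by have := ler_norm C; lra.
apply: (@le_trans _ _ (limn_esup (separation_rate f K 1))); last first.
  by apply: ereal_sup_ubound; exists 1 => //=.
rewrite limn_esup_lim; apply: lime_ge; first exact: is_cvg_esups.
apply: nearW => n; apply: (@le_trans _ _ (separation_rate f K 1 n)); last first.
  by apply: ereal_sup_ubound; exists n => //=.
(* The empty set is separated, and [ln 0] is 0 by convention, so every rate is nonnegative. *)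
apply: ereal_sup_ubound; exists [::] => /=; last by rewrite ln0 // mul0r.
by split.
Qed.

End EntropyZero.

(** * Coordinates modulo a closed subspace of finite codimension *)

Section Codim.
Variables (R : realType) (X : completeNormedModType R) (Pi : set X).
Hypotheses (linP : linear_subspace Pi) (closP : closed Pi).

Lemma subspaceD (a : R) (u v : X) : Pi u -> Pi v -> Pi (a *: u + v).
Proof. by move=> Pu Pv; have [_ /(_ a u v)] := linP; rewrite !inE; apply. Qed.

Lemma subspace0 : Pi 0.
Proof. by have [] := linP; rewrite inE. Qed.

Lemma subspaceZ (a : R) (u : X) : Pi u -> Pi (a *: u).
Proof. by move=> Pu; have := subspaceD a Pu subspace0; rewrite addr0. Qed.

Lemma lincombD (n : nat) (e : 'I_n -> X) (a b : 'I_n -> R) (c : R) :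
  lincomb e (fun i => c * a i + b i) = c *: lincomb e a + lincomb e b.
Proof.
rewrite /lincomb scaler_sumr -big_split /=; apply: eq_bigr => i _.
by rewrite scalerDl scalerA.
Qed.

Lemma lincombZ (n : nat) (e : 'I_n -> X) (a : 'I_n -> R) (c : R) :
  lincomb e (fun i => c * a i) = c *: lincomb e a.
Proof. by rewrite /lincomb scaler_sumr; apply: eq_bigr => i _; rewrite scalerA. Qed.

Lemma continuous_lincomb (T : topologicalType) (n : nat) (e : 'I_n -> X) (c : T ->
  'I_n -> R) :
  (forall i, continuous (fun x => c x i)) -> continuous (fun x => lincomb e (c x)).
Proof.
move=> cc; rewrite /lincomb; elim: (index_enum _) => [|i s IH].
  under [X in continuous X]eq_fun do rewrite big_nil.
  by move=> v; exact: cst_continuous.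
under [X in continuous X]eq_fun do rewrite big_cons.
by move=> v; apply: cvgD; [apply: cvgZ; [exact: cc|exact: cvg_cst]|exact: IH].
Qed.

Variables (n : nat) (e : 'I_n -> X).
Hypothesis indep : forall a, Pi (lincomb e a) -> forall i, a i = 0.

(* Compactness of the faces a i = 1 of the cube bounds the coordinates modulo Pi. *)
Lemma face_bound (i : 'I_n) : exists N : nat, forall (a : 'I_n -> R) (u : X),
  a i = 1 -> (forall j, `|a j| <= 1) -> Pi u -> N.+1%:R^-1 <= `|lincomb e a - u|.
Proof.
pose Q j : set R := if j == i then [set 1] else `[-1, 1]%classic.
have cQ : compact [set v : 'rV[R]_n | forall j, Q j (v ord0 j)].
  apply: rV_compact => j; rewrite /Q; case: ifP => _; first exact: compact_set1.
  exact: segment_compact.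
pose P (N : nat) (v : 'rV[R]_n) := forall u, Pi u ->
  N.+1%:R^-1 <= `|lincomb e (fun j => v ord0 j) - u|.
have ncov := (compact_near_coveringP _).1 cQ nat \oo P _.
suff: \forall N \near \oo, [set v : 'rV[R]_n | forall j, Q j (v ord0 j)] `<=` P N.
  move=> [N _ HN]; exists N => a u ai aj Pu.
  have := HN N (leqnn _) (\row_j a j) _ u Pu.
  have -> : (fun j => (\row_j a j) ord0 j) = a by apply/funext => j; rewrite mxE.
  apply=> j /=; rewrite mxE /Q; case: eqVneq => [->//|_].
  by rewrite /= in_itv /= -ler_norml.
apply: ncov => v Qv.
have nP : ~ Pi (lincomb e (fun j => v ord0 j)).
  move=> /indep/(_ i) v0; have := Qv i; rewrite /Q eqxx /= v0 => /eqP.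
  by rewrite eq_sym oner_eq0.
have [r /= r0 Hr] : exists2 r : R, 0 < r & forall u, Pi u ->
  r <= `|lincomb e (fun j => v ord0 j) - u|.
  have := closed_openC closP; rewrite openE => /(_ _ nP) /nbhs_ballP[r r0 Hr].
  exists r => // u Pu; rewrite leNgt; apply/negP => h.
  by apply: (Hr u) Pu; rewrite -ball_normE.
have r2 : 0 < r / 2 by rewrite divr_gt0.
exists ([set v' : 'rV[R]_n |
  `|lincomb e (fun j => v ord0 j) - lincomb e (fun j => v' ord0 j)| < r / 2],
   [set N | (Num.trunc (r / 2)^-1 <= N)%N]).
  have cv : continuous (fun w : 'rV[R]_n => lincomb e (fun j => w ord0 j)).
    by apply: continuous_lincomb => j; exact: coord_continuous.
  by split; [move: (cv v) => /cvgrPdist_lt/(_ _ r2)|exists (Num.trunc (r / 2)^-1)].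
move=> [v' N] [/= h hN] u Pu.
have hr := Hr u Pu.
have hN2 : N.+1%:R^-1 <= r / 2.
  rewrite -(invrK (r / 2)) lef_pV2 ?posrE ?invr_gt0 ?ltr0n //.
  by apply: le_trans (ltW (truncnS_gt _)) _; rewrite ler_nat.
have := ler_distD (lincomb e (fun j => v' ord0 j)) (lincomb e (fun j => v ord0 j)) u.
move=> h3; apply: le_trans hN2 _; rewrite -(lerD2l (r / 2)) -splitr.
by apply: le_trans hr (le_trans h3 _); rewrite lerD2r; exact: ltW.
Qed.

(** Division by the coordinate of largest modulus leads to a face of the cube, where [face_bound]
    applies; the smallest of the finitely many bounds serves as [m]. *)
Lemma coord_bound : exists2 m : R, 0 < m & forall (a : 'I_n -> R) (u : X) i,
  Pi u -> m * `|a i| <= `|lincomb e a + u|.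
Proof.
have /choice[N HN] := face_bound.
exists (\max_i N i).+1%:R^-1; first by rewrite invr_gt0 ltr0n.
move=> a u i Pu.
have [k _ Hk] := @arg_maxP _ _ _ i xpredT (fun j => `|a j|) isT.
set m := (X in X * _); have m0 : 0 < m by rewrite invr_gt0 ltr0n.
apply: (@le_trans _ _ (m * `|a k|)); first by apply: ler_wpM2l; [exact: ltW|exact: Hk].
have [->|ak] := eqVneq (a k) 0; first by rewrite normr0 mulr0.
have ak0 : 0 < `|a k| by rewrite normr_gt0.
have := HN k (fun j => (a k)^-1 * a j) (- (a k)^-1 *: u).
rewrite mulVf // => /(_ erefl) H.
have {}H : (N k).+1%:R^-1 <= `|(a k)^-1 *: (lincomb e a + u)|.
  rewrite scalerDr -lincombZ -[X in _ + X]opprK -scaleNr; apply: H;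
    last exact: subspaceZ.
  by move=> j; rewrite normrM normfV mulrC ler_pdivrMr // mul1r; exact: Hk.
move: H; rewrite normrZ normfV mulrC ler_pdivlMr // => H; apply: le_trans H.
rewrite ler_wpM2r // /m lef_pV2 ?posrE ?ltr0n // ler_nat ltnS.
exact: leq_bigmax.
Qed.

Hypothesis span : forall x, exists a, Pi (x - lincomb e a).

(** The coordinates are merely chosen, but they respect differences modulo [Pi], so [coord_bound]
    makes them Lipschitz. *)
Lemma codim_coordinates : exists A : X -> 'I_n -> R,
  (forall i, continuous (fun x => A x i)) /\
  (forall x y, A x =1 A y -> Pi (x - y)).
Proof.
have /choice[A HA] := span.
exists A.
have diff x y : Pi (x - y - lincomb e (fun i => -1 * A y i + A x i)).
  rewrite lincombD scaleN1r.
  have := subspaceD (-1) (HA y) (HA x); rewrite scaleN1r.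
  by congr Pi; rewrite !opprD !opprK addrACA [- y + x]addrC.
split; last first.
  move=> x y Axy; have := diff x y.
  have -> : lincomb e (fun i => -1 * A y i + A x i) = 0.
    by rewrite /lincomb big1 // => i _; rewrite Axy mulN1r addNr scale0r.
  by rewrite subr0.
have [m m0 Hm] := coord_bound.
move=> i x; apply/cvgrPdist_lt => eps eps0.
have d0 : 0 < eps * m by rewrite mulr_gt0.
apply/nbhs_ballP; exists (eps * m) => // y; rewrite -ball_normE /= => xy.
have := Hm (fun i => -1 * A y i + A x i) _ i (diff x y).
rewrite addrCA subrr addr0 mulN1r [- A y i + _]addrC => h.
by rewrite -(ltr_pM2l m0) (le_lt_trans h) // mulrC.
Qed.

End Codim.

(** * Recurrent orbits and nested cones *)

Lemma codim_plane (R : realType) (X : completeNormedModType R) (Pi : set X) (d : nat) :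
  linear_subspace Pi -> closed Pi -> has_codim Pi d -> d = 1%N \/ d = 2%N ->
  exists2 P : X -> R * R, continuous P & forall x y, P x = P y -> Pi (x - y).
Proof.
move=> linP closP [e [indep span]] hd.
have [A [cA HA]] := codim_coordinates linP closP indep span.
case: hd => hd; subst d.
- exists (fun x => (A x ord0, 0)).
    by apply: continuous_pair; [exact: cA|move=> x; exact: cst_continuous].
  by move=> x y [Axy]; apply: HA => i; rewrite (ord1 i).
- exists (fun x => (A x ord0, A x ord_max)).
    by apply: continuous_pair; exact: cA.
  move=> x y [A0 A1]; apply: HA => i.
  case: (unliftP ord0 i) => [j ->|->//]; rewrite (ord1 j).
  by have -> : lift ord0 ord0 = @ord_max 1 by exact: val_inj.
Qed.

Lemma within_continuous_comp (S T U : topologicalType) (A : set T) (B : set S)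
    (f : T -> U) (g : S -> T) :
  {within A, continuous f} -> continuous g -> (forall s, B s -> A (g s)) ->
  {within B, continuous (fun s => f (g s))}.
Proof.
move=> /subspace_continuousP cf cg BA; apply/subspace_continuousP => s Bs V.
move=> /(cf _ (BA s Bs)) h.
have h' : nbhs s [set y | A (g y) -> V (f (g y))] := cg s _ h.
change (nbhs s [set y | B y -> V (f (g y))]).
by apply: filterS h' => y /= Hy By; apply: Hy; exact: BA.
Qed.

Section FlowOn.
Variables (R : realType) (X : completeNormedModType R) (Gamma : set X) (Psi : R -> X ->
  X).
Hypotheses (cG : compact Gamma) (flowP : continuous_flow_on Gamma Psi).
Implicit Types (x y z w : X) (s t a b e : R).

Lemma flow_in t x : Gamma x -> Gamma (Psi t x).
Proof. by have [_ h _ _] := flowP; exact: h. Qed.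

Lemma flow0 x : Gamma x -> Psi 0 x = x.
Proof. by have [_ _ h _] := flowP; exact: h. Qed.

Lemma flowD t s x : Gamma x -> Psi t (Psi s x) = Psi (t + s) x.
Proof. by have [_ _ _ h] := flowP; exact: h. Qed.

Lemma flow_inj t x y : Gamma x -> Gamma y -> Psi t x = Psi t y -> x = y.
Proof.
move=> Gx Gy /(congr1 (Psi (- t))).
by rewrite !flowD // addNr !flow0.
Qed.

Lemma flow_near t x e : Gamma x -> 0 < e ->
  \forall y \near x, Gamma y -> `|Psi t x - Psi t y| < e.
Proof.
move=> Gx e0; have [cP _ _ _] := flowP.
have cp : continuous (fun y : X => (t, y)).
  by apply: continuous_pair => y; [exact: cst_continuous|exact: cvg_id].
have := within_continuous_comp (B := Gamma) cP cp (fun _ h => h).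
by move=> /subspace_continuousP/(_ x Gx)/cvgrPdist_lt/(_ e e0).
Qed.

Lemma flow_time_continuous x : Gamma x -> continuous (fun t => Psi t x).
Proof.
move=> Gx; have [cP _ _ _] := flowP; apply/continuous_subspace_setT.
have cp : continuous (fun t : R => (t, x)).
  by apply: continuous_pair => y; [exact: cvg_id|exact: cst_continuous].
exact: (within_continuous_comp cP cp (fun _ _ => Gx)).
Qed.

(** The orbit runs over all real times, so that its closure contains the backward orbits that occur
    in the hypothesis on [Pi]. *)
Definition orbit_closure x : set X := closure (range (fun t => Psi t x)).

Lemma orbit_in_closure x t : orbit_closure x (Psi t x).
Proof. by apply: subset_closure; exists t. Qed.

Lemma orbit_closure_sub x : Gamma x -> orbit_closure x `<=` Gamma.
Proof.
move=> Gx; have clG : closed Gamma by apply: compact_closed => //;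
  exact: norm_hausdorff.
rewrite (closure_id Gamma).1 //; apply: closure_subset => _ [t _ <-]; exact: flow_in.
Qed.

(** One [a] serves both times: [cone_constant] needs a pair of orbit points outside the cone at one
    time and inside at another. *)
Lemma orbit_closure_approx x z s t e : Gamma x -> orbit_closure x z -> 0 < e ->
  exists a, `|Psi s z - Psi s (Psi a x)| < e /\ `|Psi t z - Psi t (Psi a x)| < e.
Proof.
move=> Gx xz e0; have Gz := orbit_closure_sub Gx xz.
have [_ [[a _ <-] [h1 h2]]] := xz _ (filterI (flow_near s Gz e0) (flow_near t Gz e0)).
by exists a; split; [apply: h1|apply: h2]; exact: flow_in.
Qed.

Lemma flow_orbit_closure x z s : Gamma x -> orbit_closure x z ->
  orbit_closure x (Psi s z).
Proof.
move=> Gx xz B /nbhs_ballP[e e0 He].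
have [a [h _]] := orbit_closure_approx s s Gx xz e0.
exists (Psi (s + a) x); split; first by exists (s + a).
by apply: He; rewrite -ball_normE /= -flowD.
Qed.

Lemma orbit_closure_compact x : Gamma x -> compact (orbit_closure x).
Proof.
by move=> Gx; apply: (subclosed_compact _ cG (orbit_closure_sub Gx));
  exact: closed_closure.
Qed.

Definition flow_recurrent x : Prop :=
  forall e A : R, 0 < e -> exists2 t, A <= t & `|x - Psi t x| < e.

Lemma recurrent_approx x s t e A : Gamma x -> flow_recurrent x -> 0 < e ->
  exists2 a, A <= a & `|Psi s x - Psi s (Psi a x)| < e /\ `|Psi t x - Psi t (Psi a x)|
    < e.
Proof.
move=> Gx rx e0.
have [r /= r0 Hr] :=
  (nbhs_ballP _ _).1 (filterI (flow_near s Gx e0) (flow_near t Gx e0)).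
have [a aA ax] := rx r A r0; exists a => //.
have [|h1 h2] := Hr (Psi a x); first by rewrite -ball_normE.
by split; [apply: h1|apply: h2]; exact: flow_in.
Qed.

Variable Phi : R -> X -> X.
Hypothesis agree : forall t x, 0 <= t -> Gamma x -> Psi t x = Phi t x.

(** Recurrence passes from [x] to every [Psi a x], because [Psi a] is continuous and commutes with
    the flow. *)
Lemma orbit_closure_Birkhoff x : Gamma x -> flow_recurrent x ->
  orbit_closure x `<=` Birkhoff_center Phi.
Proof.
move=> Gx rx; apply: closure_subset => _ [a _ <-] t t0 B /nbhs_ballP[e e0 He].
have [s ts [h _]] := recurrent_approx a a t Gx rx e0.
have s0 : 0 <= s by apply: le_trans ts.
exists (Phi s (Psi a x)); split; first by exists s.
rewrite -agree //; last exact: flow_in.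
by apply: He; rewrite -ball_normE /= flowD // (addrC s) -flowD.
Qed.

(* On the orbit closure of a recurrent point, a pair of orbits cannot enter the
   cone: entering is an open condition, pairs (Psi a x, Psi b x) are dense among
   all pairs, and these are recurrent for the product flow while the cone can
   not be left. *)
Lemma cone_constant (Kc : set X) x z w s t : closed Kc ->
  (forall v (l : R), Kc v -> Kc (l *: v)) -> uesm_cone Phi Kc ->
  Gamma x -> flow_recurrent x -> orbit_closure x z -> orbit_closure x w ->
  Kc (Psi s z - Psi s w) -> Kc (Psi t z - Psi t w).
Proof.
move=> clK scK [T T0 HT] Gx rx xz xw Ks; apply: contrapT => nKt.
have Gz := orbit_closure_sub Gx xz; have Gw := orbit_closure_sub Gx xw.
have K0 : Kc 0 by rewrite -(scale0r (Psi s z - Psi s w)); exact: scK.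
have neq0 u v a b : Gamma u -> Gamma v -> ~ Kc (Psi a u - Psi a v) ->
  Psi b u - Psi b v <> 0.
  move=> Gu Gv nK /eqP; rewrite subr_eq0 => /eqP /(flow_inj Gu Gv) uv.
  by apply: nK; rewrite uv subrr.
have step u v a b : Gamma u -> Gamma v -> Kc (Psi a u - Psi a v) ->
  Psi a u - Psi a v <> 0 ->
    a + T <= b -> interior Kc (Psi b u - Psi b v).
  move=> Gu Gv Ka n0 ab.
  have := HT (Psi a u) (Psi a v) _ (b - a); rewrite -!agree;
    [|lra|exact: flow_in|lra|exact: flow_in].
  by rewrite !flowD // subrK; apply; [split|lra].
have intK : interior Kc (Psi (s + T) z - Psi (s + T) w).
  by apply: (step _ _ s) => //; exact: (neq0 _ _ t).
have openC v : ~ Kc v -> exists2 r : R, 0 < r & forall v', `|v - v'| < r -> ~ Kc v'.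
  move=> nK; have := closed_openC clK; rewrite openE => /(_ _ nK) /nbhs_ballP[r r0 Hr].
  by exists r => // v' h; apply: Hr; rewrite -ball_normE.
have [r1 r10 Hr1] := openC _ nKt.
have /nbhs_ballP[r2 /= r20 Hr2] := intK.
pose r := Num.min (r1 / 2) (r2 / 2).
have r0 : 0 < r by rewrite lt_min !divr_gt0.
have [rr1 rr2] : r <= r1 / 2 /\ r <= r2 / 2 by rewrite !ge_min !lexx orbT.
have dist4 (u u' v v' : X) (c : R) : `|u - u'| < c / 2 -> `|v - v'| < c / 2 ->
    `|(u - v) - (u' - v')| < c.
  move=> h1 h2; have -> : (u - v) - (u' - v') = (u - u') - (v - v').
    by rewrite !opprB addrACA [RHS]addrACA [- v + _]addrC.
  by apply: le_lt_trans (ler_normB _ _) _; rewrite (splitr c) ltrD.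
have [a [a1 a2]] := orbit_closure_approx t (s + T) Gx xz r0.
have [b [b1 b2]] := orbit_closure_approx t (s + T) Gx xw r0.
have Ga := flow_in a Gx; have Gb := flow_in b Gx.
have nK' : ~ Kc (Psi t (Psi a x) - Psi t (Psi b x)).
  by apply: Hr1; apply: dist4; [exact: lt_le_trans a1 rr1|exact: lt_le_trans b1 rr1].
have K' : Kc (Psi (s + T) (Psi a x) - Psi (s + T) (Psi b x)).
  apply: Hr2; rewrite -ball_normE /=.
  by apply: dist4; [exact: lt_le_trans a2 rr2|exact: lt_le_trans b2 rr2].
have [r3 r30 Hr3] := openC _ nK'.
have r32 : 0 < r3 / 2 by rewrite divr_gt0.
(* Recurrence brings the pair back near its position at time [t], outside the cone, at a time
   [c + t >= s + 2 T]. Having been inside at time [s + T], it is still inside then, which is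
   absurd. *)
have [c cA [c1 c2]] := recurrent_approx (t + a) (t + b) (s + 2 * T - t) Gx rx r32.
apply: (Hr3 (Psi (c + t) (Psi a x) - Psi (c + t) (Psi b x))).
  rewrite !flowD // in c1 c2 *.
  have -> : c + t + a = t + a + c by ring.
  have -> : c + t + b = t + b + c by ring.
  exact: dist4.
apply: interior_subset; apply: (step _ _ (s + T)) => //; last lra.
exact: (neq0 _ _ t).
Qed.

Variables (N : xnat) (C : xnat -> set X).
Hypotheses (nicP : NICs Phi N C) (uesmP : uesm Phi N C).

(** By [cone_constant], membership in a proper cone does not depend on time, so the least index at
    time 0 works. If no finite index does, [N] is infinite and the index is [None], whose
    predecessor is the union of the finite cones. *)
Lemma cone_index x z w : Gamma x -> flow_recurrent x ->
  orbit_closure x z -> orbit_closure x w -> z <> w ->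
  exists i : xnat, [/\ xnat_le (Some 1%N) i, xnat_le i N &
    forall t, (C i `\` prev_cone C i) (Psi t z - Psi t w)].
Proof.
move=> Gx rx xz xw zw.
have Gz := orbit_closure_sub Gx xz; have Gw := orbit_closure_sub Gx xw.
have [clC [[C0 _ CN] [k [Hk _]] _]] := nicP.
have const m s t : (1 <= m)%N -> xnat_lt (Some m) N ->
    C (Some m) (Psi s z - Psi s w) -> C (Some m) (Psi t z - Psi t w).
  move=> m1 mN; have [[_ sc _ _] _] := Hk m m1 mN.
  have clm : closed (C (Some m)).
    by apply: clC; move: mN; rewrite /xnat_lt; case: (N) => //= n; lia.
  exact: (@cone_constant _ x z w s t clm sc (uesmP m1 mN) Gx rx xz xw).
have neq t : Psi t z - Psi t w <> 0.
  by move=> /eqP; rewrite subr_eq0 => /eqP /(flow_inj Gz Gw).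
have [[m [mN Cm]]|nC] := pselect (exists m : nat, xnat_le (Some m) N /\
    C (Some m) (Psi 0 z - Psi 0 w)); last first.
  have NN : N = None.
    case EN : N => [n|//]; case: nC; exists n; rewrite -EN CN; split => //.
    by rewrite EN /=.
  exists None; rewrite NN; split => // t; split; first by rewrite -NN CN.
  move=> [m _ Cm]; apply: nC; exists m; rewrite NN; split => //.
  case: m Cm => [|m] Cm; last by apply: const Cm; rewrite ?NN.
  by have := neq t; move: Cm; rewrite C0 /= => ->.
pose p (m : nat) := `[< xnat_le (Some m) N /\ C (Some m) (Psi 0 z - Psi 0 w) >].
have ex : exists m, p m by exists m; apply/asboolP.
have [{}m /asboolP[{}mN {}Cm] min] := ex_minnP ex.
have m1 : (1 <= m)%N.
  case: m Cm {min mN} => // Cm; have := neq 0; move: Cm; rewrite C0 /= => ->.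
  by [].
exists (Some m); split => // t; split.
  have [mN'|] := boolP (xnat_lt (Some m) N); first exact: const Cm.
  rewrite /xnat_lt negbK => Nm.
  have -> : Some m = N.
    by move: mN Nm; case: (N) => //= n h1 h2; congr Some; lia.
  by rewrite CN.
rewrite /prev_cone => Cm1.
have mN1 : xnat_lt (Some m.-1) N by move: mN; rewrite /xnat_lt; case: (N) => //= n; lia.
case: m m1 min mN Cm Cm1 mN1 => // -[|m] _ min mN Cm /= Cm1 mN1.
  by move: Cm1; rewrite C0 /=; exact: neq.
have /min : p m.+1.
  apply/asboolP; split; last exact: const Cm1.
  by move: mN1; rewrite /xnat_lt; case: (N) => //= n; lia.
by rewrite ltnn.
Qed.

End FlowOn.

(** * Periodicity of recurrent points *)

(** Pigeonhole: among [M + 1] integers modulo [tau], two fall into the same of [M] arcs of length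
    [tau / M < e]. *)
Lemma dirichlet (R : realType) (tau e : R) : 0 < tau -> 0 < e ->
  exists (p k : nat), (0 < p)%N /\ `|p%:R - k%:R * tau| < e.
Proof.
move=> tau0 e0.
pose M := (Num.trunc (tau / e)).+1.
have M0 : 0 < (M%:R : R) by rewrite ltr0n.
have Me : tau < e * M%:R by rewrite mulrC -ltr_pdivrMr // truncnS_gt.
pose j (n : nat) := Num.trunc (n%:R * M%:R / tau).
have jP n : (j n)%:R * tau <= n%:R * M%:R < ((j n)%:R + 1) * tau.
  have h0 : 0 <= n%:R * M%:R / tau by rewrite divr_ge0 ?(ltW tau0) ?mulr_ge0.
  have := truncn_itv h0; rewrite -/(j n) => /andP[].
  by rewrite ler_pdivlMr // ltr_pdivrMr // -natr1 => -> ->.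
pose c (n : 'I_M.+1) : 'I_M := Ordinal (ltn_pmod (j n) (ltn0Sn _)).
have /injectivePn[n [n' nn' E]] : ~~ injectiveb c.
  by apply/negP => /injectiveP /leq_card; rewrite !card_ord ltnn.
wlog lt_nn : n n' nn' E / (n < n')%N.
  move=> H; case: (ltngtP n n') => h; [exact: (H n n')|by apply: (H n' n) => //;
    rewrite eq_sym|].
  by move/eqP: nn'; case; exact: val_inj.
have jle : (j n <= j n')%N.
  rewrite le_truncn // ler_pdivrMr // divfK ?gt_eqF // ler_wpM2r ?ler_nat //;
    exact: ltnW.
have /dvdnP[k Hk] : (M %| j n' - j n)%N.
  by rewrite -eqn_mod_dvd //; apply/eqP; move: E => /(congr1 val).
exists (n' - n)%N, k; split; first by rewrite subn_gt0.
have Hk' : (j n')%:R - (j n)%:R = k%:R * M%:R :> R by rewrite -natrB // Hk natrM.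
have /andP[a1 a2] := jP n; have /andP[b1 b2] := jP n'.
rewrite natrB ?(ltnW lt_nn) // -(ltr_pM2r M0) -[X in _ * X < _]gtr0_norm // -normrM.
apply: lt_trans Me; rewrite mulrBl mulrBl mulrAC -Hk'; rewrite ltr_norml.
by apply/andP; split; lra.
Qed.

Section Periodicity.
Variables (R : realType) (X : completeNormedModType R) (Gamma : set X) (Psi : R -> X ->
  X).
Hypotheses (cG : compact Gamma) (flowP : continuous_flow_on Gamma Psi).

Lemma flow_slow (d : R) : 0 < d -> exists2 m : R, 0 < m &
  forall u z, Gamma z -> `|u| < m -> `|Psi u z - z| <= d.
Proof.
move=> d0; pose K : set (R * X) := `[-1, 1] `*` Gamma.
have cK : compact K by apply: compact_setX => //; exact: segment_compact.
have [cP _ _ _] := flowP.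
have cPK : {within K, continuous (fun q => Psi q.1 q.2)}.
  by apply: continuous_subspaceW cP => q [].
have c1 : continuous (fun q : R * X => `|q.1|).
  by move=> q; apply: cvg_norm; exact: cvg_fst.
have c2 : continuous (fun q : R * X => q.2) by move=> q; exact: cvg_snd.
have cg : {within K, continuous (fun q => `|q.1| +
  Num.max 0 (d - `|Psi q.1 q.2 - q.2|))}.
  have c3 : {within K, continuous (fun q => d - `|Psi q.1 q.2 - q.2|)}.
    move=> q; apply: cvgB; first exact: cvg_cst.
    by apply: cvg_norm; apply: cvgB; [exact: cPK|exact: (continuous_subspaceT c2)].
  by move=> q; apply: cvgD;
    [exact: (continuous_subspaceT c1)|exact: (continuous_max0 c3)].
have [|m m0 Hm] := compact_pos_lb cK cg.
  move=> [u z] [/= _ Gz]; have [->|u0] := eqVneq u 0.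
    rewrite /= (flow0 flowP) // subrr !normr0.
    by rewrite subr0 add0r lt_max d0 orbT.
  by apply: ltr_wpDr; rewrite ?normr_gt0 // le_max lexx.
exists (Num.min m 1); first by rewrite lt_min m0 ltr01.
move=> u z Gz; rewrite lt_min => /andP[um u1].
have /Hm : K (u, z) by split => //=; rewrite in_itv /= -ler_norml ltW.
rewrite /= => h; rewrite leNgt; apply/negP => dlt; move: h.
by rewrite max_l ?subr_le0 ?(ltW dlt) // addr0 leNgt um.
Qed.

(** An integer [p] close to a multiple of [tau] acts on the orbit as a short time does, and
    [flow_slow] bounds that displacement uniformly. *)
Lemma periodic_almost_period (x : X) (tau : R) : Gamma x -> 0 < tau -> Psi tau x = x ->
  forall d : R, 0 < d -> exists2 p : nat, (0 < p)%N &
    forall i : nat, `|Psi (i + p)%:R x - Psi i%:R x| <= d.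
Proof.
move=> Gx tau0 xtau d d0.
have [m m0 Hm] := flow_slow d0.
have [p [k [p0 pk]]] := dirichlet tau0 m0.
have xk (n : nat) : Psi (n%:R * tau) x = x.
  elim: n => [|n IH]; first by rewrite mul0r (flow0 flowP).
  by rewrite -natr1 mulrDl mul1r -(flowD flowP) // xtau.
exists p => // i.
have -> : Psi (i + p)%:R x = Psi (p%:R - k%:R * tau) (Psi i%:R x).
  rewrite -[in RHS](xk k) !(flowD flowP) //; last exact: (flow_in flowP).
  by congr (Psi _ x); rewrite natrD; ring.
by apply: Hm => //; exact: (flow_in flowP).
Qed.

(** Without a period, time parametrises the orbit injectively, and so does its projection, which
    [injective_curve_not_recurrent] excludes. *)
Lemma planar_recurrent_periodic (P : X -> R * R) (x : X) : continuous P -> Gamma x ->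
  flow_recurrent Psi x ->
  (forall z w, orbit_closure Psi x z -> orbit_closure Psi x w -> P z = P w -> z = w) ->
  exists2 tau : R, 0 < tau & Psi tau x = x.
Proof.
move=> cP Gx rx injP; apply: contrapT => nper.
have [cPsi _ _ _] := flowP.
have orb t : orbit_closure Psi x (Psi t x) by exact: orbit_in_closure.
have sub := orbit_closure_sub cG flowP Gx.
pose p t := P (Psi t x).
have cp : continuous p by exact: continuous_compT (flow_time_continuous flowP Gx) cP.
have ne s t : s < t -> Psi s x <> Psi t x.
  move=> st /(congr1 (Psi (- s)));
    rewrite !(flowD flowP) // addNr (flow0 flowP) // => e.
  by apply: nper; exists (- s + t); [lra|].
have inj_p : injective p.
  move=> s t /(injP _ _ (orb s) (orb t)) e; case: (ltgtP s t) => // /ne; first by [].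
  by rewrite e.
apply: (injective_curve_not_recurrent cp inj_p).
(* Strands: on the compact [K] the first summand of the function bounded below vanishes only at
   [z = Psi 1 x], by injectivity of [P], and there the second one equals [e]. *)
- move=> e e0; pose Z := orbit_closure Psi x; pose K : set (R * X) := `[- (1 / 2),
    1 / 2] `*` Z.
  have cK : compact K.
    by apply: compact_setX;
      [exact: segment_compact|exact: (orbit_closure_compact cG flowP)].
  have cPK : {within K, continuous (fun q => P (Psi q.1 q.2))}.
    apply: (continuous_compT _ cP).
    by apply: continuous_subspaceW cPsi => q [_ /sub].
  have c1 : continuous (fun q : R * X => P q.2).
    by apply: continuous_compT cP => q; exact: cvg_snd.
  have c2 : continuous (fun q : R * X => p (1 + q.1)).
    apply: (continuous_compT _ cp) => q; apply: cvgD; [exact: cvg_cst|exact: cvg_fst].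
  have c3 : continuous (fun q : R * X => p 1) by move=> q; exact: cvg_cst.
  have cg1 := continuous_plane_sqdist c1 c3.
  have cg2 := continuous_plane_sqdist cPK (continuous_subspaceT c2).
  have cg : {within K, continuous (fun q : R * X =>
      (((P q.2).1 - (p 1).1) ^+ 2 + ((P q.2).2 - (p 1).2) ^+ 2) +
      Num.max 0 (e - (((P (Psi q.1 q.2)).1 - (p (1 + q.1)).1) ^+ 2 +
                      ((P (Psi q.1 q.2)).2 - (p (1 + q.1)).2) ^+ 2)))}.
    have c4 : {within K, continuous (fun q : R * X =>
      e - (((P (Psi q.1 q.2)).1 - (p (1 + q.1)).1) ^+ 2 +
           ((P (Psi q.1 q.2)).2 - (p (1 + q.1)).2) ^+ 2))}.
      by move=> q; apply: cvgB; [exact: cvg_cst|exact: cg2].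
    by move=> q; apply: cvgD;
      [exact: (continuous_subspaceT cg1)|exact: (continuous_max0 c4)].
  have [|m m0 Hm] := compact_pos_lb cK cg.
    move=> [u z] [/= _ Zz].
    have [zx|zx] := eqVneq z (Psi 1 x).
      rewrite zx (flowD flowP) // [u +
        1]addrC -/(p _) !subrr expr0n /= !addr0 add0r subr0.
      by rewrite lt_max e0 orbT.
    apply: ltr_wpDr; first by rewrite le_max lexx.
    rewrite lt0r addr_ge0 ?sqr_ge0 // andbT; apply: contra zx.
    rewrite paddr_eq0 ?sqr_ge0 // !sqrf_eq0 !subr_eq0 => /andP[/eqP h1 /eqP h2].
    apply/eqP/injP => //.
    by rewrite (surjective_pairing (P z)) h1 h2 -surjective_pairing.
  exists (m / 2); first by rewrite divr_gt0.
  move=> s u hu hs.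
  have /Hm : K (u, Psi s x) by split => /=; [rewrite in_itv /= -ler_norml|exact: orb].
  rewrite /= (flowD flowP) // [u + s]addrC -/(p _) -/(sqdist p (s + u) (1 +
    u)) -/(sqdist p s 1).
  move=> h; rewrite leNgt; apply/negP => lt_e; move: h.
  by rewrite max_l ?subr_le0 ?(ltW lt_e) //; lra.
- move=> t0 e A e0.
  have cPt : {within Gamma, continuous (fun y => P (Psi t0 y))}.
    apply: (continuous_compT _ cP).
    apply: (within_continuous_comp cPsi (g := fun y => (t0, y))) => //.
    by apply: continuous_pair => y; [exact: cvg_cst|exact: cvg_id].
  have cc : {within Gamma, continuous (fun _ : X => p t0)} by move=> y; exact: cvg_cst.
  have /subspace_continuousP/(_ x Gx)/cvgrPdist_lt/(_ e e0) :=
    continuous_plane_sqdist cPt cc.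
  rewrite /= -/(p t0) !subrr expr0n /= addr0 => /nbhs_ballP[r r0 Hr].
  have [a aA ax] := rx r (A - t0) r0.
  exists (t0 + a); first by lra.
  have := Hr (Psi a x); rewrite -ball_normE /= => /(_ ax (flow_in flowP a Gx)).
  by rewrite /from_subspace (flowD flowP) // sub0r normrN => /(le_lt_trans (ler_norm
    _)).
Qed.

Variable Phi : R -> X -> X.
Hypothesis agree : forall t x, 0 <= t -> Gamma x -> Psi t x = Phi t x.

Lemma iter_time_one n x : Gamma x -> iter n (Phi 1) x = Psi n%:R x.
Proof.
move=> Gx; elim: n => [|n IH] /=; first by rewrite (flow0 flowP).
by rewrite IH -agree ?(flowD flowP) ?nat1r //; exact: (flow_in flowP).
Qed.

(** If no iterate hits [x], the first finitely many stay at a positive distance [r] from it, so a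
    return closer than [r] is late. *)
Lemma time_one_recurrent x : Gamma x ->
  (forall e : R, 0 < e -> exists2 n : nat, (0 < n)%N & `|iter n (Phi 1) x - x| < e) ->
  (exists2 tau : R, 0 < tau & Psi tau x = x) \/ flow_recurrent Psi x.
Proof.
move=> Gx Hrec.
have [[n n0 xn]|nper] := pselect (exists2 n : nat, (0 < n)%N & iter n (Phi 1) x = x).
  by left; exists n%:R; rewrite ?ltr0n // -iter_time_one.
right=> e A e0.
have far M : exists2 r : R, 0 < r & forall n, (0 < n <= M)%N ->
  r <= `|iter n (Phi 1) x - x|.
  elim: M => [|M [r r0 Hr]]; first by exists 1 => // n; lia.
  exists (Num.min r `|iter M.+1 (Phi 1) x - x|).
    rewrite lt_min r0 normr_gt0 subr_eq0; apply/eqP => h; apply: nper.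
    by exists M.+1.
  move=> n /andP[n0]; rewrite leq_eqVlt ltnS => /orP[/eqP ->|nM];
    rewrite ge_min ?lexx ?orbT //.
  by rewrite Hr ?n0.
have [r r0 Hr] := far (Num.trunc A).+1.
have [|n n0] := Hrec (Num.min e r); first by rewrite lt_min e0.
rewrite lt_min => /andP[ne nr]; exists n%:R.
  rewrite ltW // (lt_trans (truncnS_gt _)) // ltr_nat ltnNge; apply/negP => h.
  by move: nr; rewrite ltNge Hr // n0.
by rewrite distrC -iter_time_one.
Qed.

End Periodicity.

(** * From nested cones to zero entropy *)

Theorem theoremD (R : realType) (X : completeNormedModType R)
    (Phi : R -> X -> X) (Gamma : set X)
    (N : xnat) (C : xnat -> set X) (Pi : set X) (d : nat) :
  continuous_semiflow Phi ->
  eventually_compact Phi ->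
  global_attractor Phi Gamma ->
  NICs Phi N C ->
  uesm Phi N C ->
  linear_subspace Pi ->
  closed Pi ->
  has_codim Pi d ->
  (forall i : xnat, xnat_le (Some 1%N) i -> xnat_le i N ->
    forall x y : X, Birkhoff_center Phi x -> Birkhoff_center Phi y -> x <> y ->
    (forall s : R, 0 < s ->
      exists x' y' : X,
        [/\ Birkhoff_center Phi x', Birkhoff_center Phi y',
            Phi s x' = x, Phi s y' = y &
            forall t : R, 0 <= t ->
              ((C i `\` prev_cone C i) `|` [set 0]) (Phi t x' - Phi t y')]) ->
    ~ Pi (x - y)) ->
  extends_to_flow Phi Gamma ->
  d = 1%N \/ d = 2%N ->
  semiflow_entropy Phi Gamma = 0%E.
Proof.
move=> [cPhi _ _] _ [_ cG _ _] nicP uesmP linP closP codimP Hcone [Psi flowP agree] d12.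
have [P cP HP] := codim_plane linP closP codimP d12.
have inG t x : Gamma x -> Gamma (Psi t x) by exact: (flow_in flowP).
have injP x z w : Gamma x -> flow_recurrent Psi x -> orbit_closure Psi x z ->
    orbit_closure Psi x w -> P z = P w -> z = w.
  move=> Gx rx xz xw /HP Pzw; apply: contrapT => zw.
  have Gz := orbit_closure_sub cG flowP Gx xz; have Gw :=
    orbit_closure_sub cG flowP Gx xw.
  have center := orbit_closure_Birkhoff flowP agree Gx rx.
  have [i [i1 iN Hi]] := cone_index cG flowP agree nicP uesmP Gx rx xz xw zw.
  apply: (Hcone i i1 iN z w (center _ xz) (center _ xw) zw _ Pzw) => s s0.
  (* The flow supplies the past of [z] and [w] inside the orbit closure, and [cone_index] holds at
     all times, negative ones included. *)
  exists (Psi (- s) z), (Psi (- s) w); split.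
  - exact/center/(flow_orbit_closure cG flowP).
  - exact/center/(flow_orbit_closure cG flowP).
  - by rewrite -agree ?(flowD flowP) ?subrr ?(flow0 flowP) ?(ltW s0) //; exact: inG.
  - by rewrite -agree ?(flowD flowP) ?subrr ?(flow0 flowP) ?(ltW s0) //; exact: inG.
  - move=> t t0; left; rewrite -!agree ?(flowD flowP) //; exact: inG.
apply: topological_entropy_eq0 => //.
- by move=> x Gx; rewrite -agree //; exact: inG.
- have c1 : continuous (fun y : X => (1 : R, y)).
    by apply: continuous_pair => y; [exact: cvg_cst|exact: cvg_id].
  exact: (within_continuous_comp (B := Gamma) cPhi c1 (fun _ _ => ler01)).
- move=> x Gx Hrec d0 d0_gt0.
  have [tau tau0 xtau] : exists2 tau : R, 0 < tau & Psi tau x = x.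
    have [//|rx] := time_one_recurrent flowP agree Gx Hrec.
    by apply: (planar_recurrent_periodic cG flowP cP Gx rx) => z w; exact: injP.
  have [p p0 Hp] := periodic_almost_period cG flowP Gx tau0 xtau d0_gt0.
  by exists p => // i; rewrite !(iter_time_one flowP agree).
Qed.
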